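(* For every positive non-decreasing function $f:[1,\infty)\to(0,\infty)$ such that $\lim_{t\to\infty}f(t)=\infty$, there exists a sequence $(S_n)_{n\in\mathbb N}$ of finite symmetric generating subsets of the discrete Heisenberg group $\mathbb H(\mathbb Z)$ such that $|S_n^n|\ll f(n)n^3|S_n|$ (that is, $|S_n^n|\le Cf(n)n^3|S_n|$ for all $n$, for some constant $C$), whilst $(\mathbb H(\mathbb Z),d_{S_n}/n)$ GH-converges to the real Heisenberg group $\mathbb H(\mathbb R)$ equipped with the left-invariant Carnot--Carath\'eodory metric associated to the $\ell^\infty$-norm on $\mathbb R^2$, whose Hausdorff dimension coincides with the homogeneous dimension of $\mathbb H(\mathbb R)$ (which is $4$).
   Context: $\mathbb H(\mathbb R)$ is the group of real matrices $\left(\begin{smallmatrix}1&u&w\\0&1&v\\0&0&1\end{smallmatrix}\right)$, and $\mathbb H(\mathbb Z)$ is its subgroup of matrices with integer entries. $d_S$ is the word metric associated to $S$, and $S^n=\{s_1\cdots s_n:s_i\in S\}$. Metric groups are pointed at the identity. Carnot--Carath\'eodory metric associated to a norm $\|\cdot\|$ on $\mathbb R^2$: let $\mathfrak m$ be the subspace of the Lie algebra of $\mathbb H(\mathbb R)$ spanned by the elementary matrices $E_{12},E_{23}$, identified with $\mathbb R^2$ via $uE_{12}+vE_{23}\leftrightarrow(u,v)$. A smooth path $\gamma:[0,1]\to\mathbb H(\mathbb R)$ is horizontal if $\gamma(t)^{-1}\gamma'(t)\in\mathfrak m$ for all $t$, and its length is $\int_0^1\|\gamma(t)^{-1}\gamma'(t)\|\,dt$;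 $d(x,y)$ is the infimum of the lengths of piecewise-horizontal paths from $x$ to $y$. GH-convergence: a sequence of compact metric spaces $Y_n$ GH-converges to a compact metric space $Y$ if the $Y_n$ have bounded diameter and there are maps $\phi_n:Y_n\to Y$ such that for every $\varepsilon>0$, for all $n$ large enough, every point of $Y$ is within $\varepsilon$ of $\phi_n(Y_n)$ and $(1-\varepsilon)d(x,y)-\varepsilon\le d(\phi_n(x),\phi_n(y))\le(1+\varepsilon)d(x,y)+\varepsilon$ for all $x,y\in Y_n$. A sequence of locally compact pointed metric spaces $(X_n,o_n)$ GH-converges to the locally compact pointed metric space $(X,o)$ if for every $R>0$ the balls $B(o_n,R)$ GH-converge to $B(o,R)$. The homogeneous dimension of a connected nilpotent Lie group with Lie algebra $\mathfrak g$ is $\sum_{i\ge1}i\dim(\mathfrak C^i(\mathfrak g)/\mathfrak C^{i+1}(\mathfrak g))$, where $\mathfrak C^1(\mathfrak g)=\mathfrak g$ and $\mathfrak C^{i+1}(\mathfrak g)=[\mathfrak g,\mathfrak C^i(\mathfrak g)]$. *)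

(* Defs.v *)
From HB Require Import structures.
From mathcomp Require Import all_boot all_order all_algebra.
From mathcomp Require Export finmap.
From mathcomp Require Import all_classical all_reals all_analysis.

Set Implicit Arguments.
Unset Strict Implicit.
Unset Printing Implicit Defensive.

Import Order.TTheory GRing.Theory Num.Theory.
Import numFieldNormedType.Exports.

Local Open Scope classical_set_scope.
Local Open Scope ring_scope.

Definition heis_mat (K : comNzRingType) (u v w : K) : 'M[K]_3 :=
  \matrix_(i, j) (nth [::] [:: [:: 1; u; w];
                               [:: 0; 1; v];
                               [:: 0; 0; 1]] i)`_j.

Definition is_heis (K : comNzRingType) (A : 'M[K]_3) : bool :=
  A == heis_mat (A 0 1) (A 1 2) (A 0 2).

Record heis (K : comNzRingType) :=
  Heis { heis_mx :> 'M[K]_3; heis_mxP : is_heis heis_mx }.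

HB.instance Definition _ (K : comNzRingType) := [isSub for @heis_mx K].
HB.instance Definition _ (K : comNzRingType) := [Choice of heis K by <:].

Lemma is_heis_mat (K : comNzRingType) (u v w : K) : is_heis (heis_mat u v w).
Proof. by apply/eqP; rewrite !mxE. Qed.

Lemma heis_mat1 (K : comNzRingType) : heis_mat 0 0 0 = 1%:M :> 'M[K]_3.
Proof.
apply/matrixP => -[[|[|[|//]]] ?] -[[|[|[|//]]] ?]; by rewrite !mxE.
Qed.

Lemma heis_matM (K : comNzRingType) (u v w u' v' w' : K) :
  heis_mat u v w *m heis_mat u' v' w' =
  heis_mat (u + u') (v + v') (w + w' + u * v').
Proof.
apply/matrixP => i j; rewrite !mxE !big_ord_recl big_ord0 !mxE.
case: i j => -[|[|[|//]]] ? [[|[|[|//]]] ?] /=;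
  rewrite ?(mul0r, mul1r, mulr0, mulr1, add0r, addr0) //; try by rewrite addrC.
by rewrite [_ + w]addrC addrA [w' + w]addrC.
Qed.

Lemma is_heisM (K : comNzRingType) (A B : 'M[K]_3) :
  is_heis A -> is_heis B -> is_heis (A *m B).
Proof. by move=> /eqP-> /eqP->; rewrite heis_matM is_heis_mat. Qed.

Definition heis_mul (K : comNzRingType) (A B : heis K) : heis K :=
  Heis (is_heisM (heis_mxP A) (heis_mxP B)).

Lemma is_heis1 (K : comNzRingType) : is_heis (1%:M : 'M[K]_3).
Proof. by rewrite -heis_mat1 is_heis_mat. Qed.

Definition heis_one (K : comNzRingType) : heis K := Heis (is_heis1 K).

Definition heis_inv (K : comNzRingType) (A : heis K) : heis K :=
  Heis (is_heis_mat (- A 0 1) (- A 1 2) (A 0 1 * A 1 2 - A 0 2)).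

Lemma heis_mulA (K : comNzRingType) : associative (@heis_mul K).
Proof. by move=> A B C; apply/val_inj; rewrite /= mulmxA. Qed.

Lemma heis_mul1g (K : comNzRingType) : left_id (heis_one K) (@heis_mul K).
Proof. by move=> A; apply/val_inj; rewrite /= mul1mx. Qed.

Lemma heis_mulg1 (K : comNzRingType) : right_id (heis_one K) (@heis_mul K).
Proof. by move=> A; apply/val_inj; rewrite /= mulmx1. Qed.

Lemma heis_mulVg (K : comNzRingType) :
  left_inverse (heis_one K) (@heis_inv K) (@heis_mul K).
Proof.
move=> A; apply/val_inj => /=; rewrite [X in _ *m X](eqP (heis_mxP A)) heis_matM.
by rewrite /= -heis_mat1 !addNr mulNr subrK subrr.
Qed.

Lemma heis_mulgV (K : comNzRingType) :
  right_inverse (heis_one K) (@heis_inv K) (@heis_mul K).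
Proof.
move=> A; apply/val_inj => /=; rewrite [X in X *m _](eqP (heis_mxP A)) heis_matM.
by rewrite -heis_mat1 !subrr mulrN addrCA !subrr addr0 subrr.
Qed.

HB.instance Definition _ (K : comNzRingType) :=
  isGroup.Build (heis K) (@heis_mulA K) (@heis_mul1g K) (@heis_mulg1 K)
    (@heis_mulVg K) (@heis_mulgV K).

Section Words.
Context (G : groupType).
Local Open Scope group_scope.
Local Open Scope fset_scope.

Definition symmetric_fset (S : {fset G}) : Prop :=
  forall s, s \in S -> s^-1 \in S.

Definition generating_fset (S : {fset G}) : Prop :=
  forall H : set G,
    H 1 -> (forall x y, H x -> H y -> H (x * y)) ->
    (forall x, H x -> H x^-1) -> (forall s, s \in S -> H s) ->
    forall x, H x.

(* [fset_pow S n] is the set of products of exactly [n] elements of [S]. *)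
Definition fset_pow (S : {fset G}) (n : nat) : {fset G} :=
  iter n (fun A => [fset a * s | a in A, s in S]) [fset 1].

(* Meant for symmetric [S], for which inverses of generators are not needed in
   the words; the set of lengths is nonempty when [S] moreover generates. *)
Definition word_dist (R : realType) (S : {fset G}) (x y : G) : R :=
  inf [set k%:R | k in [set k : nat | x^-1 * y \in fset_pow S k]].

End Words.

Section CarnotCaratheodory.
Context (R : realType).

Definition horizontal_space : {vspace 'M[R]_3} :=
  <<[:: delta_mx 0 1; delta_mx 1 2]%R>>%VS.

(* A smooth path on [0, 1] is given by a smooth function on the whole line, of
   which only the restriction to [0, 1] matters; this is smoothness up to the
   end points. *)
Definition smooth_path (g : R -> heis R) : Prop :=
  forall (n : nat) (t : R), derivable (derive1n n (fun s => heis_mx (g s))) t 1.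

Definition velocity (g : R -> heis R) (t : R) : 'M[R]_3 :=
  heis_mx (g t)^-1%g *m derive1 (fun s => heis_mx (g s)) t.

Definition horizontal_path (g : R -> heis R) : Prop :=
  smooth_path g /\ forall t, 0 <= t <= 1 -> velocity g t \in horizontal_space.

Definition cc_length (N : R * R -> R) (g : R -> heis R) : R :=
  \int[@lebesgue_measure R]_(t in `[0, 1])
    N (velocity g t 0 1, velocity g t 1 2).

(* Piecewise-horizontal paths are lists of horizontal paths, each starting where
   the previous one ends. *)
Fixpoint joins (x : heis R) (gs : seq (R -> heis R)) (y : heis R) : Prop :=
  if gs is g :: gs' then [/\ horizontal_path g, g 0 = x & joins (g 1) gs' y]
  else x = y.

Definition cc_dist (N : R * R -> R) (x y : heis R) : R :=
  inf [set \sum_(g <- gs) cc_length N g | gs in [set gs | joins x gs y]].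

Definition linf_norm (p : R * R) : R := Num.max `|p.1| `|p.2|.

End CarnotCaratheodory.

Record is_metric (R : realType) (T : Type) (d : T -> T -> R) : Prop := {
  is_metric_xx : forall x, d x x = 0;
  is_metric_pos : forall x y, d x y = 0 -> x = y;
  is_metric_sym : forall x y, d x y = d y x;
  is_metric_tri : forall y x z, d x z <= d x y + d y z }.

Definition metrized (R : realType) (T : choiceType) (d : T -> T -> R)
  (dP : is_metric d) : Type := T.

HB.instance Definition _ (R : realType) (T : choiceType) (d : T -> T -> R)
  (dP : is_metric d) := Choice.on (metrized dP).
HB.instance Definition _ (R : realType) (T : choiceType) (d : T -> T -> R)
  (dP : is_metric d) :=
  isMetric.Build R (metrized dP) (is_metric_xx dP) (is_metric_pos dP)
    (is_metric_sym dP) (is_metric_tri dP).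

Definition compact_metric (R : realType) (T : choiceType) (d : T -> T -> R)
  (A : set T) : Prop :=
  exists dP : is_metric d, compact (A : set (metrized dP)).

(* Convergence of the compact metric spaces [A_ n], with the metric induced by
   [d_ n], to the compact metric space [A], with the metric induced by [d]. *)
Definition gh_cvg (R : realType)
    (T_ : nat -> choiceType) (d_ : forall n, T_ n -> T_ n -> R)
    (A_ : forall n, set (T_ n))
    (T : choiceType) (d : T -> T -> R) (A : set T) : Prop :=
  [/\ forall n, compact_metric (d_ n) (A_ n),
      compact_metric d A,
      exists D : R, forall n x y, A_ n x -> A_ n y -> d_ n x y <= D &
      exists phi : forall n, T_ n -> T,
        (forall n x, A_ n x -> A (phi n x)) /\
        forall eps : R, 0 < eps -> \forall n \near \oo,
          (forall y, A y -> exists2 x, A_ n x & d (phi n x) y <= eps) /\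
          (forall x y, A_ n x -> A_ n y ->
            (1 - eps) * d_ n x y - eps <= d (phi n x) (phi n y)
              <= (1 + eps) * d_ n x y + eps)].

Definition cball (R : realType) (T : Type) (d : T -> T -> R) (o : T) (r : R)
  : set T := [set x | d o x <= r].

Definition pointed_gh_cvg (R : realType)
    (T_ : nat -> choiceType) (d_ : forall n, T_ n -> T_ n -> R)
    (o_ : forall n, T_ n)
    (T : choiceType) (d : T -> T -> R) (o : T) : Prop :=
  forall r : R, 0 < r ->
    gh_cvg d_ (fun n => cball (d_ n) (o_ n) r) d (cball d o r).

Section Hausdorff.
Context (R : realType) (T : Type) (d : T -> T -> R).
Local Open Scope ereal_scope.

Definition diam (U : set T) : \bar R :=
  ereal_sup [set (d p.1 p.2)%:E | p in U `*` U].

(* The empty set gets weight 0, also for [s = 0]. *)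
Definition diam_pow (s : R) (U : set T) : \bar R :=
  if pselect (U = set0) then 0 else poweR (diam U) s.

Definition hausdorff_content (s delta : R) (A : set T) : \bar R :=
  ereal_inf [set \sum_(k <oo) diam_pow s (U k) | U in
    [set U : nat -> set T |
      (forall k, diam (U k) <= delta%:E) /\ A `<=` \bigcup_k U k]].

Definition hausdorff_measure (s : R) (A : set T) : \bar R :=
  ereal_sup [set hausdorff_content s delta A | delta in
    [set delta : R | (0 < delta)%R]].

Definition hausdorff_dim : \bar R :=
  ereal_inf [set s%:E | s in
    [set s : R | (0 <= s)%R /\ hausdorff_measure s setT = 0]].

End Hausdorff.

Section Homogeneous.
Context (R : realType) (n : nat).
Implicit Types U V : {vspace 'M[R]_n}.

Definition mx_bracket (A B : 'M[R]_n) : 'M[R]_n := A *m B - B *m A.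

Definition bracketv U V : {vspace 'M[R]_n} :=
  <<[seq mx_bracket x y | x <- vbasis U, y <- vbasis V]>>%VS.

(* [bracketv U V] is the span of all brackets. *)
Lemma bracketvP U V (W : {vspace 'M[R]_n}) :
  (forall x y, x \in U -> y \in V -> mx_bracket x y \in W) <->
  (bracketv U V <= W)%VS.
Proof.
split=> [UVW|/subvP sW x y xU yV].
  apply/span_subvP => _ /allpairsP[[x y] /= [xU yV ->]].
  by apply: UVW; apply: vbasis_mem.
rewrite (coord_vbasis xU) /mx_bracket mulmx_suml mulmx_sumr -sumrB.
apply: rpred_sum => i _; rewrite -scalemxAl -scalemxAr -scalerBr rpredZ //.
rewrite (coord_vbasis yV) mulmx_suml mulmx_sumr -sumrB.
apply: rpred_sum => j _; rewrite -scalemxAl -scalemxAr -scalerBr rpredZ //.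
apply/sW/memv_span/allpairsP.
exists ((vbasis U)`_i, (vbasis V)`_j) => /=; split=> //;
  by apply: mem_nth; rewrite size_tuple.
Qed.

(* Indexed from 1: [lower_central g 1 = g]. *)
Definition lower_central (g : {vspace 'M[R]_n}) (i : nat) :
  {vspace 'M[R]_n} := iter i.-1 (bracketv g) g.

Definition homogeneous_dim (g : {vspace 'M[R]_n}) : \bar R :=
  (\sum_(1 <= i <oo)
    (i * (\dim (lower_central g i) - \dim (lower_central g i.+1)))%N%:R%:E)%E.

End Homogeneous.

(* The Lie algebra of the real Heisenberg group: the strictly upper triangular
   matrices. *)
Definition heis_lie (R : realType) : {vspace 'M[R]_3} :=
  <<[:: delta_mx 0 1; delta_mx 1 2; delta_mx 0 2]%R>>%VS.

(* Main.v *)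
Require Import Defs.
From mathcomp Require Import all_boot all_order all_algebra.
From mathcomp Require Import all_classical all_reals all_analysis.
From mathcomp Require Import measurable_realfun.
From mathcomp Require Import ring lra zify.

Set Implicit Arguments.
Unset Strict Implicit.
Unset Printing Implicit Defensive.

Import Order.TTheory GRing.Theory Num.Theory.
Import numFieldNormedType.Exports.

Local Open Scope classical_set_scope.
Local Open Scope ring_scope.

(** The generating sets are the boxes [heis_gen n W] of elements whose first two
    coordinates are at most [n] and whose third one is at most [W], once corrected
    by half of their product so as to make the set symmetric. With
    [W = n ^ 3 / g n], where [g <= f] tends to infinity slowly, two effects
    balance.

    The products of [n] generators fill a box of sides [n ^ 2], [n ^ 2] and about
    [n ^ 4], the last exponent coming from the areas that horizontal words
    enclose, whereas there are about [n ^ 2 W] generators: the ratio is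
    [n ^ 3 g n] ([heis_gen_growth]). At the same time, [n] steps move the third
    coordinate by [n W = n ^ 4 / g n] only, apart from these areas, and this is
    negligible against [n ^ 4]. So after the dilation of ratio [n ^ -2] only the
    first two coordinates of a generator matter; they fill the unit ball of the
    sup norm, which is the norm of the limit.

    To make this precise, the Carnot-Caratheodory metric is first expressed
    through finite words of horizontal vectors, the polygonal horizontal paths
    ([cc_dist_le_word], [cc_dist_lt_word]). All later arguments are about such
    words: their length is additive, they can be cut at any length, reversed and
    dilated, and the area they enclose is at most the square of their length.
    A product of [k] generators is a word of length [k n] times a central
    element of size [k W], which costs the square root of its size
    ([ccn_psi_le]). Conversely, a word of length [k n] ending at an integer point
    is cut into [k] pieces of length [n] and the cutting points are rounded down;
    since [n ^ 2] is small against [W], consecutive rounded points differ by a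
    generator ([floor_word]). Hence both norms agree up to an additive error
    that tends to 0 on balls ([word_dist_psi_le]), and the rescaled embedding is
    a Gromov-Hausdorff approximation. It may slightly overshoot the ball, which a
    dilation of ratio close to 1 corrects ([gh_map]).

    For the Hausdorff dimension, the norm of a point is comparable to the maximum
    of [|u|], [|v|] and [sqrt |w|]. Translates of the dilated unit cube by the
    lattice of mesh [1 / N] cover a fixed box with about [N ^ 4] sets of diameter
    about [1 / N], so the measure of exponent [s > 4] vanishes
    ([box_content]). A set of small diameter [r] lies in a sheared box of Lebesgue
    measure of order [r ^ 4], so a cover of small weight of exponent [s < 4] would
    have too little volume to cover the unit cube ([diam_box]). *)

(** * Coordinates on the Heisenberg group *)

Section Coordinates.
Context (K : comNzRingType).
Implicit Types x y : heis K.

Definition mk (u v w : K) : heis K := Heis (is_heis_mat u v w).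
Definition hu x : K := heis_mx x 0 1.
Definition hv x : K := heis_mx x 1 2.
Definition hw x : K := heis_mx x 0 2.

Lemma hu_mk u v w : hu (mk u v w) = u. Proof. by rewrite /hu !mxE. Qed.
Lemma hv_mk u v w : hv (mk u v w) = v. Proof. by rewrite /hv !mxE. Qed.
Lemma hw_mk u v w : hw (mk u v w) = w. Proof. by rewrite /hw !mxE. Qed.

Lemma mk_eta x : x = mk (hu x) (hv x) (hw x).
Proof. by apply/val_inj; rewrite /= {1}(eqP (heis_mxP x)). Qed.

Lemma mk_mul u v w u' v' w' :
  (mk u v w * mk u' v' w')%g = mk (u + u') (v + v') (w + w' + u * v').
Proof. by apply/val_inj; rewrite /= heis_matM. Qed.

Lemma mk_one : 1%g = mk 0 0 0 :> heis K.
Proof. by apply/val_inj; rewrite /= heis_mat1. Qed.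

Lemma mk_inv u v w : (mk u v w)^-1%g = mk (- u) (- v) (u * v - w).
Proof. by apply/val_inj; rewrite /= !mxE. Qed.

Lemma heis_eqP x y : hu x = hu y -> hv x = hv y -> hw x = hw y -> x = y.
Proof. by move=> eu ev ew; rewrite (mk_eta x) (mk_eta y) eu ev ew. Qed.

Lemma huM x y : hu (x * y)%g = hu x + hu y.
Proof. by rewrite {1}(mk_eta x) {1}(mk_eta y) mk_mul hu_mk. Qed.
Lemma hvM x y : hv (x * y)%g = hv x + hv y.
Proof. by rewrite {1}(mk_eta x) {1}(mk_eta y) mk_mul hv_mk. Qed.
Lemma hwM x y : hw (x * y)%g = hw x + hw y + hu x * hv y.
Proof. by rewrite {1}(mk_eta x) {1}(mk_eta y) mk_mul hw_mk. Qed.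
Lemma huV x : hu x^-1%g = - hu x.
Proof. by rewrite {1}(mk_eta x) mk_inv hu_mk. Qed.
Lemma hvV x : hv x^-1%g = - hv x.
Proof. by rewrite {1}(mk_eta x) mk_inv hv_mk. Qed.
Lemma hwV x : hw x^-1%g = hu x * hv x - hw x.
Proof. by rewrite {1}(mk_eta x) mk_inv hw_mk. Qed.
Lemma hu1 : hu 1%g = 0 :> K. Proof. by rewrite mk_one hu_mk. Qed.
Lemma hv1 : hv 1%g = 0 :> K. Proof. by rewrite mk_one hv_mk. Qed.
Lemma hw1 : hw 1%g = 0 :> K. Proof. by rewrite mk_one hw_mk. Qed.

Definition heisE := (huM, hvM, hwM, huV, hvV, hwV, hu1, hv1, hw1,
  hu_mk, hv_mk, hw_mk).

Definition dil (t : K) x : heis K :=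
  mk (t * hu x) (t * hv x) (t ^+ 2 * hw x).

Lemma dilM t x y : dil t (x * y)%g = (dil t x * dil t y)%g.
Proof. by apply: heis_eqP; rewrite /dil !heisE; ring. Qed.

Lemma dilV t x : dil t x^-1%g = ((dil t x)^-1)%g.
Proof. by apply: heis_eqP; rewrite /dil !heisE; ring. Qed.

Lemma dil1 x : dil 1 x = x.
Proof. by apply: heis_eqP; rewrite /dil !heisE; ring. Qed.

Lemma dil_dil s t x : dil s (dil t x) = dil (s * t) x.
Proof. by apply: heis_eqP; rewrite /dil !heisE; ring. Qed.

Lemma dil_one t : dil t 1%g = 1%g.
Proof. by apply: heis_eqP; rewrite /dil !heisE; ring. Qed.

End Coordinates.

(** * Words of horizontal vectors *)

(** A word stands for the polygonal horizontal path whose successive sides are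
    the one-parameter subgroups tangent to its letters. *)
Section Words.
Context (R : realType).
Implicit Types (p : R * R) (om : seq (R * R)).

(** The exponential of the horizontal vector [p]. *)
Definition hexp p : heis R := mk p.1 p.2 (p.1 * p.2 / 2).
Definition wend om : heis R := foldr (fun p x => hexp p * x)%g 1%g om.
Definition wlen om : R := \sum_(p <- om) linf_norm p.

Lemma linf_norm_ge0 p : 0 <= linf_norm p.
Proof. by rewrite /linf_norm le_max normr_ge0. Qed.

Lemma linf_norm_fst p : `|p.1| <= linf_norm p.
Proof. by rewrite /linf_norm le_max lexx. Qed.

Lemma linf_norm_snd p : `|p.2| <= linf_norm p.
Proof. by rewrite /linf_norm le_max lexx orbT. Qed.

Lemma linf_normZ t p : linf_norm (t * p.1, t * p.2) = `|t| * linf_norm p.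
Proof. by rewrite /linf_norm /= !normrM maxr_pMr. Qed.

Lemma wlen_ge0 om : 0 <= wlen om.
Proof. by apply: sumr_ge0 => p _; exact: linf_norm_ge0. Qed.

Lemma wlen_cons p om : wlen (p :: om) = linf_norm p + wlen om.
Proof. by rewrite /wlen big_cons. Qed.

Lemma wlen1 p : wlen [:: p] = linf_norm p.
Proof. by rewrite /wlen big_seq1. Qed.

Lemma wlen_cat om om' : wlen (om ++ om') = wlen om + wlen om'.
Proof. by rewrite /wlen big_cat. Qed.

Lemma wend_cat om om' : wend (om ++ om') = (wend om * wend om')%g.
Proof. by elim: om => [|p om IH] /=; rewrite ?mul1g// IH mulgA. Qed.

Lemma hexpZ t p : hexp (t * p.1, t * p.2) = dil t (hexp p).
Proof. by apply: heis_eqP; rewrite /hexp /dil !heisE//=; ring. Qed.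

Lemma hexpV p : hexp (- p.1, - p.2) = ((hexp p)^-1)%g.
Proof. by apply: heis_eqP; rewrite /hexp !heisE//=; field. Qed.

Definition wdil t om := [seq (t * p.1, t * p.2) | p <- om].
Definition wrev om := rev [seq (- p.1, - p.2) | p <- om].

Lemma wend_dil t om : wend (wdil t om) = dil t (wend om).
Proof. by elim: om => [|p om IH] /=; rewrite ?dil_one// dilM hexpZ IH. Qed.

Lemma wlen_dil t om : wlen (wdil t om) = `|t| * wlen om.
Proof.
rewrite /wlen /wdil big_map mulr_sumr; apply: eq_bigr => p _.
exact: linf_normZ.
Qed.

Lemma wend_rev om : wend (wrev om) = ((wend om)^-1)%g.
Proof.
elim: om => [|p om IH]; first by rewrite /= invg1.
by rewrite /wrev /= rev_cons -cats1 wend_cat -/(wrev om) IH /= mulg1 hexpV invgM.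
Qed.

Lemma wlen_rev om : wlen (wrev om) = wlen om.
Proof.
rewrite /wlen /wrev (perm_big _ (permEl (perm_rev _))) big_map.
by apply: eq_bigr => p _; rewrite /linf_norm /= !normrN.
Qed.

Lemma wend_hu om : `|hu (wend om)| <= wlen om.
Proof.
elim: om => [|p om IH] /=; first by rewrite hu1 normr0 wlen_ge0.
rewrite heisE /hexp heisE wlen_cons (le_trans (ler_normD _ _))// lerD//.
exact: linf_norm_fst.
Qed.

Lemma wend_hv om : `|hv (wend om)| <= wlen om.
Proof.
elim: om => [|p om IH] /=; first by rewrite hv1 normr0 wlen_ge0.
rewrite heisE /hexp heisE wlen_cons (le_trans (ler_normD _ _))// lerD//.
exact: linf_norm_snd.
Qed.

(** The quantity bounded here is the area enclosed between the projection of
    the path to the plane and its chord. *)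
Lemma wend_area om :
  `|hw (wend om) - hu (wend om) * hv (wend om) / 2| <= wlen om ^+ 2.
Proof.
elim: om => [|p om IH] /=.
  by rewrite !heisE mul0r mul0r subr0 normr0 sqr_ge0.
rewrite wlen_cons !heisE /=.
set u := hu _; set v := hv _; set w := hw _; rewrite -/u -/v -/w in IH.
have := wend_hu om; rewrite -/u => hu_le.
have := wend_hv om; rewrite -/v => hv_le.
have := linf_norm_fst p; have := linf_norm_snd p; have := linf_norm_ge0 p.
move: hu_le hv_le IH (wlen_ge0 om).
case: p => a b /=; set l := linf_norm _; set L := wlen om.
move=> uL vL IH L0 l0 bl al.
have -> : a * b / 2 + w + a * v - (a + u) * (b + v) / 2 =
  (w - u * v / 2) + (a * v - b * u) / 2 by field.
apply: le_trans (ler_normD _ _) _.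
have abuv : `|(a * v - b * u) / 2| <= l * L.
  rewrite normrM (@ger0_norm _ 2^-1) ?invr_ge0// ler_pdivrMr//.
  rewrite (le_trans (ler_normB _ _))// mulr_natr mulr2n lerD// normrM ler_pM//.
have : 0 <= l * L by rewrite mulr_ge0.
move=> lL.
have l2 : 0 <= l ^+ 2 by rewrite sqr_ge0.
by rewrite sqrrD mulr2n; lra.
Qed.

(** A commutator square of side [s] encloses the area [s ^+ 2]. *)
Lemma central_word (c : R) :
  exists om, wend om = mk 0 0 c /\ wlen om = 4 * Num.sqrt `|c|.
Proof.
pose s := Num.sqrt `|c|.
have s0 : 0 <= s by rewrite sqrtr_ge0.
have s2 : s ^+ 2 = `|c| by rewrite sqr_sqrtr.
pose e : R := Num.sg c.
have cE : c = e * s ^+ 2 by rewrite s2 /e -numEsg.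
exists [:: (e * s, 0); (0, s); (- (e * s), 0); (0, - s)]; split.
  apply: heis_eqP; rewrite /= /hexp /= !heisE ?mulr1; [ring|ring|].
  by rewrite [RHS]cE; field.
have [c00|c0] := eqVneq c 0.
  have s00 : s = 0 by rewrite /s c00 normr0 sqrtr0.
  rewrite -/s s00 /wlen !big_cons big_nil /linf_norm /=.
  by rewrite !mulr0 !oppr0 normr0 maxxx !addr0.
have es : `|e * s| = s.
  by rewrite normrM normr_sg c0 mul1r ger0_norm.
rewrite /wlen !big_cons big_nil /linf_norm /= !normrN normr0 es (ger0_norm s0).
by rewrite !(max_r s0) !(max_l s0); rewrite -/s; ring.
Qed.

Lemma point_word (u v w : R) :
  exists om, wend om = mk u v w /\
             wlen om = `|u| + `|v| + 4 * Num.sqrt `|w|.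
Proof.
have [om [omE oml]] := central_word w.
exists ((0, v) :: (u, 0) :: om); split.
  by apply: heis_eqP; rewrite /= omE /hexp !heisE /=; field.
rewrite !wlen_cons oml /linf_norm /= normr0 max_r// max_l//; ring.
Qed.

(** A cut inside a letter splits it into two parallel letters, whose
    exponentials multiply back to the original one. *)
Lemma word_cut om (s : R) : 0 <= s <= wlen om ->
  exists om1 om2, [/\ (wend om1 * wend om2)%g = wend om,
    wlen om1 = s & wlen om2 = wlen om - s].
Proof.
elim: om s => [|p om IH] s.
  rewrite /wlen big_nil => /andP[s0 s0']; have -> : s = 0 by lra.
  by exists [::], [::]; rewrite mul1g big_nil subr0.
rewrite wlen_cons => /andP[s0 sL].
have [ps|sp] := leP (linf_norm p) s.
  have [|om1 [om2 [e1 l1 l2]]] := IH (s - linf_norm p).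
    by apply/andP; split; lra.
  exists (p :: om1), om2; split; rewrite ?wlen_cons; [|lra|lra].
  by rewrite /= -mulgA e1.
have p0 : 0 < linf_norm p by lra.
pose t := s / linf_norm p.
have t0 : 0 <= t by rewrite divr_ge0// ltW.
have t1 : t <= 1 by rewrite ler_pdivrMr// mul1r ltW.
have tp : t * linf_norm p = s by rewrite /t mulfVK// gt_eqF.
exists [:: (t * p.1, t * p.2)], ((( 1 - t) * p.1, (1 - t) * p.2) :: om); split.
- rewrite /= mulg1 mulgA; congr (_ * _)%g.
  by apply: heis_eqP; rewrite /hexp !heisE /=; field.
- by rewrite wlen_cons /wlen big_nil addr0 linf_normZ ger0_norm.
- rewrite wlen_cons linf_normZ ger0_norm ?subr_ge0// mulrBl mul1r tp; ring.
Qed.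

End Words.

(** * Horizontal paths are almost words *)

Section HorizontalPaths.
Context (R : realType).
Implicit Types (g : R -> heis R).

Lemma heis_entry (x : heis R) (i j : 'I_3) : heis_mx x i j =
  heis_mat (hu x) (hv x) (hw x) i j.
Proof. by rewrite {1}(mk_eta x). Qed.

Lemma horizontal_spaceP (A : 'M[R]_3) : A \in horizontal_space R -> A 0 2 = 0.
Proof.
rewrite /horizontal_space span_cons span_seq1.
by move=> /memv_addP[x /vlineP[a ->]] [y /vlineP[b ->] ->]; rewrite !mxE /=; ring.
Qed.

Lemma horizontal_spaceI (a b : R) :
  a *: delta_mx 0 1 + b *: delta_mx 1 2 \in horizontal_space R.
Proof.
rewrite rpredD// rpredZ//; apply: memv_span; rewrite !inE eqxx ?orbT//.
Qed.

Lemma smooth_derivable_entry g (i j : 'I_3) (t : R) : smooth_path g ->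
  derivable (fun s => heis_mx (g s) i j) t 1.
Proof. by move=> /(_ 0%N t) /= /derivable_mxP. Qed.

Lemma smooth_derive1_entry g (i j : 'I_3) (t : R) : smooth_path g ->
  derive1 (fun s => heis_mx (g s)) t i j =
  derive1 (fun s => heis_mx (g s) i j) t.
Proof.
move=> /(_ 0%N t) /= dg; rewrite !derive1E.
by rewrite (@derive_mx R R^o _ _ _ t 1 dg) mxE.
Qed.

Lemma smooth_derivable2_entry g (i j : 'I_3) (t : R) : smooth_path g ->
  derivable (derive1 (fun s => heis_mx (g s) i j)) t 1.
Proof.
move=> sg; have := sg 1%N t => /= /derivable_mxP/(_ i j).
suff -> : (fun x => derive1 (fun s => heis_mx (g s)) x i j) =
          derive1 (fun s => heis_mx (g s) i j) by [].
by apply/funext => s; rewrite smooth_derive1_entry.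
Qed.

(** The last entry is the contact form [dw - u dv], which horizontality
    annihilates: the third coordinate of a horizontal path is determined by the
    first two. *)
Lemma velocityE g t : smooth_path g ->
  [/\ velocity g t 0 1 = derive1 (fun s => hu (g s)) t,
      velocity g t 1 2 = derive1 (fun s => hv (g s)) t &
      velocity g t 0 2 =
        derive1 (fun s => hw (g s)) t - hu (g t) * derive1 (fun s => hv (g s)) t].
Proof.
move=> sg.
have D i j : derive1 (fun s => heis_mx (g s)) t i j =
    derive1 (fun s => heis_mat (hu (g s)) (hv (g s)) (hw (g s)) i j) t.
  rewrite smooth_derive1_entry//; congr (derive1 _ t).
  by apply/funext => s; exact: heis_entry.
have D0 (f : R -> R) c : f = cst c -> derive1 f t = 0.
  by move=> ->; rewrite derive1_cst.
have D11 : derive1 (fun s => heis_mx (g s)) t 1 1 = 0.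
  by rewrite D; apply: (D0 _ 1); apply/funext => s; rewrite !mxE.
have D21 : derive1 (fun s => heis_mx (g s)) t 2 1 = 0.
  by rewrite D; apply: (D0 _ 0); apply/funext => s; rewrite !mxE.
have D22 : derive1 (fun s => heis_mx (g s)) t 2 2 = 0.
  by rewrite D; apply: (D0 _ 1); apply/funext => s; rewrite !mxE.
have E1 : derive1 (fun s => heis_mx (g s)) t 0 1 = derive1 (fun s => hu (g s)) t.
  by rewrite smooth_derive1_entry.
have E2 : derive1 (fun s => heis_mx (g s)) t 1 2 = derive1 (fun s => hv (g s)) t.
  by rewrite smooth_derive1_entry.
have E3 : derive1 (fun s => heis_mx (g s)) t 0 2 = derive1 (fun s => hw (g s)) t.
  by rewrite smooth_derive1_entry.
pose A := heis_mat (- hu (g t)) (- hv (g t)) (hu (g t) * hv (g t) - hw (g t)).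
pose B := derive1 (fun s => heis_mx (g s)) t.
have M i j : velocity g t i j =
    A i 0 * B 0 j + A i 1 * B 1 j + A i 2 * B 2 j.
  have o1 : lift ord0 ord0 = 1 :> 'I_3 by apply/val_inj.
  have o2 : lift ord0 (lift ord0 ord0) = 2 :> 'I_3 by apply/val_inj.
  rewrite /velocity mxE !big_ord_recl big_ord0 addr0 addrA o1 o2.
  by rewrite !heis_entry !heisE.
by split; rewrite M /B ?D11 ?D21 ?D22 ?E1 ?E2 ?E3 !mxE /=; ring.
Qed.

Section Path.
Variables (g : R -> heis R) (gh : horizontal_path g).
Let u t := hu (g t).
Let v t := hv (g t).
Let w t := hw (g t).
Let speed t := linf_norm (derive1 u t, derive1 v t).

Let is_derive_entry (i j : 'I_3) (t : R) :
  is_derive t 1 (fun s => heis_mx (g s) i j)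
    (derive1 (fun s => heis_mx (g s) i j) t).
Proof.
rewrite derive1E; apply: DeriveDef => //.
by apply: smooth_derivable_entry; case: gh.
Qed.

Let du (t : R) : is_derive t 1 u (derive1 u t). Proof. exact: is_derive_entry. Qed.
Let dv (t : R) : is_derive t 1 v (derive1 v t). Proof. exact: is_derive_entry. Qed.

Let dw (t : R) : 0 <= t <= 1 -> is_derive t 1 w (u t * derive1 v t).
Proof.
move=> t01; have [_ _ V3] := velocityE t (proj1 gh).
have := horizontal_spaceP (proj2 gh t t01).
rewrite V3 => /eqP; rewrite subr_eq0 => /eqP <-; exact: is_derive_entry.
Qed.

Let cvg_derivable (f : R -> R) : (forall t, derivable f t 1) -> continuous f.
Proof. by move=> df t; exact/differentiable_continuous/derivable1_diffP. Qed.

Let cv : continuous v.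
Proof. by apply: cvg_derivable => t; have [] := dv t. Qed.
Let cw : continuous w.
Proof.
by apply: cvg_derivable => t; apply: smooth_derivable_entry; case: gh.
Qed.
Let cdu : continuous (derive1 u).
Proof.
by apply: cvg_derivable => t; apply: smooth_derivable2_entry; case: gh.
Qed.
Let cdv : continuous (derive1 v).
Proof.
by apply: cvg_derivable => t; apply: smooth_derivable2_entry; case: gh.
Qed.
Let continuous_norm (f : R -> R) : continuous f -> continuous (fun t => `|f t|).
Proof. by move=> cf t; apply: (@cvg_norm R R^o); exact: cf. Qed.
Let cspeed : continuous speed.
Proof.
move=> t; rewrite /speed /linf_norm /=.
apply: (@continuous_max _ _ (fun t => `|derive1 u t|) (fun t => `|derive1 v t|)).
  exact: continuous_norm.
exact: continuous_norm.
Qed.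

Let integrable_continuous (f : R -> R) a b : continuous f ->
  lebesgue_measure.-integrable `[a, b] (EFin \o f).
Proof.
move=> cf; apply: continuous_compact_integrable; first exact: segment_compact.
exact: continuous_subspaceT.
Qed.

Let cc_lengthE : cc_length (@linf_norm R) g =
  \int[@lebesgue_measure R]_(t in `[0, 1]) speed t.
Proof.
apply: eq_Rintegral => t _; have [-> -> _] := velocityE t (proj1 gh).
by [].
Qed.

Let chord_le (f : R -> R) (a b : R) : a <= b ->
  (forall t : R, is_derive t 1 f (derive1 f t)) -> continuous (derive1 f) ->
  (forall t, `|derive1 f t| <= speed t) ->
  `|f b - f a| <= \int[@lebesgue_measure R]_(t in `[a, b]) speed t.
Proof.
rewrite le_eqVlt => /predU1P[->|ab] df cdf fs.
  rewrite subrr normr0; apply: Rintegral_ge0 => t _; exact: linf_norm_ge0.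
have cf : continuous f by apply: cvg_derivable => t; have [] := df t.
have <- : \int[@lebesgue_measure R]_(t in `[a, b]) derive1 f t = f b - f a.
  rewrite /Rintegral (@continuous_FTC2 _ (derive1 f) f a b)//.
    exact: continuous_subspaceT.
  split.
  - by move=> t _; have [] := df t.
  - exact/cvg_at_right_filter/cf.
  - exact/cvg_at_left_filter/cf.
apply: le_trans (le_normr_Rintegral _ _) _ => //.
  exact: integrable_continuous.
apply: le_Rintegral => //.
- by apply: (@integrable_continuous (fun t => `|derive1 f t|)); exact: continuous_norm.
- exact: integrable_continuous.
Qed.

Let speed_bounded : exists2 M, 0 <= M & forall t, 0 <= t <= 1 -> speed t <= M.
Proof.
have [|c _ cM] := @EVT_max R speed 0 1 ler01.
  exact: continuous_subspaceT.
exists (speed c); first exact: linf_norm_ge0.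
by move=> t t01; apply: cM; rewrite in_itv.
Qed.

Let lipschitz (f : R -> R) (M a b : R) : 0 <= a -> a <= b -> b <= 1 ->
  (forall t : R, is_derive t 1 f (derive1 f t)) ->
  (forall t, 0 <= t <= 1 -> `|derive1 f t| <= M) -> `|f b - f a| <= M * (b - a).
Proof.
move=> a0 ab b1 df fM.
have [|c cab ->] := @MVT_segment _ f (derive1 f) a b ab (fun t _ => df t).
  apply: continuous_subspaceT; apply: cvg_derivable => t.
  by have [] := df t.
rewrite normrM (ger0_norm (_ : 0 <= b - a)) ?subr_ge0//.
apply: ler_wpM2r; first by rewrite subr_ge0.
by apply: fM; move: cab; rewrite in_itv /= => /andP[? ?]; apply/andP; split; lra.
Qed.

(** Over a short time the third coordinate is driven by the variation of the
    first one times the speed of the second one, hence it moves by a quantity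
    quadratic in the time. *)
Let area_le (M a b : R) : 0 <= M -> (forall t, 0 <= t <= 1 -> speed t <= M) ->
  0 <= a -> a <= b -> b <= 1 ->
  `|w b - w a - u a * (v b - v a)| <= M ^+ 2 * (b - a) ^+ 2.
Proof.
move=> M0 sM a0 ab b1.
pose h t := w t - u a * v t.
have dh (t : R) : t \in `]a, b[%R -> is_derive t 1 h ((u t - u a) * derive1 v t).
  rewrite in_itv /= => /andP[at_ tb].
  have wt : is_derive t 1 w (u t * derive1 v t).
    by apply: dw; apply/andP; split; lra.
  have vt := dv t.
  by rewrite mulrBl; exact: (is_deriveB wt (is_deriveZ (u a) vt)).
have ch : continuous h.
  move=> t; apply: (@cvgB R R^o); first exact: cw.
  by apply: (@cvgM R); [exact: cvg_cst|exact: cv].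
have [|c cab] := @MVT_segment _ h _ a b ab dh.
  exact: continuous_subspaceT.
have -> : h b - h a = w b - w a - u a * (v b - v a) by rewrite /h; ring.
move=> ->; move: cab; rewrite in_itv /= => /andP[ac cb].
have c01 : 0 <= c <= 1 by apply/andP; split; lra.
have ba : 0 <= b - a by rewrite subr_ge0.
have uc : `|u c - u a| <= M * (b - a).
  apply: (@le_trans _ _ (M * (c - a))).
    apply: (@lipschitz u M a c a0 ac (le_trans cb b1) du) => t t01.
    apply: le_trans (sM t t01).
    exact: (linf_norm_fst (derive1 u t, derive1 v t)).
  by apply: ler_wpM2l => //; rewrite lerD2r.
have vc : `|derive1 v c| <= M.
  apply: le_trans (sM c c01).
  exact: (linf_norm_snd (derive1 u c, derive1 v c)).
rewrite !normrM (ger0_norm ba).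
have -> : M ^+ 2 * (b - a) ^+ 2 = (M * (b - a)) * M * (b - a) by ring.
by apply: ler_wpM2r => //; apply: ler_pM.
Qed.

(** The path is replaced by the polygon inscribed at the times [i / m]; each
    side misses the endpoint by a central element of size [O(m ^ -2)], and
    central elements commute with everything, so that the [m] errors add up. *)
Lemma horizontal_path_word (e : R) : 0 < e -> exists om c,
  [/\ g 1 = (g 0 * wend om * mk 0 0 c)%g,
      wlen om <= cc_length (@linf_norm R) g & `|c| <= e].
Proof.
move=> e0; have [M M0 sM] := speed_bounded.
(* Each of the [m] sides has a central error of at most [2 M ^ 2 / m ^ 2]. *)
pose m := (Num.truncn (2 * M ^+ 2 / e)).+1.
have mr0 : 0 < m%:R :> R by rewrite ltr0n.
have mM : 2 * M ^+ 2 / m%:R <= e.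
  rewrite ler_pdivrMr// [e * _]mulrC -ler_pdivrMr//
.  exact/ltW/truncnS_gt.
pose t k : R := k%:R / m%:R.
have tS k : t k.+1 = t k + m%:R^-1 by rewrite /t -addn1 natrD mulrDl mul1r.
have t0 k : 0 <= t k by rewrite divr_ge0.
suff H k : (k <= m)%N -> exists om c,
  [/\ g (t k) = (g 0 * wend om * mk 0 0 c)%g,
      wlen om <= \int[@lebesgue_measure R]_(t in `[0, t k]) speed t &
      `|c| <= k%:R * (2 * M ^+ 2 / m%:R ^+ 2)].
  have [om [c [gE oml cle]]] := H m (leqnn m).
  have t1 : t m = 1 by rewrite /t divff// gt_eqF.
  exists om, c; rewrite cc_lengthE; split; rewrite -?t1//.
  apply: le_trans cle (le_trans _ mM); rewrite le_eqVlt; apply/orP; left.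
  by apply/eqP; field; rewrite gt_eqF.
elim: k => [|k IH] km.
  exists [::], 0; rewrite /t mul0r; split.
  - by rewrite /= -mk_one !mulg1.
  - by rewrite /wlen big_nil; apply: Rintegral_ge0 => s _; exact: linf_norm_ge0.
  - by rewrite normr0 mul0r.
have [om [c [gE oml cle]]] := IH (ltnW km).
have tk1 : t k.+1 <= 1 by rewrite /t ler_pdivrMr// mul1r ler_nat.
have mi0 : 0 < m%:R^-1 :> R by rewrite invr_gt0.
have tkS : t k <= t k.+1 by rewrite tS; lra.
pose p := (u (t k.+1) - u (t k), v (t k.+1) - v (t k)).
pose c' := w (t k.+1) - w (t k) - u (t k) * (v (t k.+1) - v (t k)) -
  p.1 * p.2 / 2.
exists (om ++ [:: p]), (c + c'); split.
- have -> : g (t k.+1) = (g (t k) * hexp p * mk 0 0 c')%g.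
    by apply: heis_eqP; rewrite /hexp !heisE /c' /p /u /v /w /=; field.
  rewrite gE wend_cat /=; apply: heis_eqP; rewrite /hexp !heisE /=; ring.
- rewrite wlen_cat wlen1.
  have -> : \int[@lebesgue_measure R]_(s in `[0, t k.+1]) speed s =
    \int[@lebesgue_measure R]_(s in `[0, t k]) speed s +
    \int[@lebesgue_measure R]_(s in `[t k, t k.+1]) speed s.
    rewrite -(@Rintegral_itv_obnd_cbnd R); last first.
      apply: integrableS (integrable_continuous (t k) (t k.+1) cspeed) => //.
      by apply: subset_itvr; rewrite bnd_simp.
    rewrite -(@Rintegral_itvB R speed (BLeft 0) (BRight (t k.+1)) (t k)).
    - by rewrite addrC subrK.
    - exact: integrable_continuous.
    - by rewrite bnd_simp.
    - by rewrite bnd_simp.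
  apply: lerD => //; rewrite /linf_norm ge_max.
  apply/andP; split.
    apply: (@chord_le u _ _ tkS du cdu) => s.
    exact: (linf_norm_fst (derive1 u s, derive1 v s)).
  apply: (@chord_le v _ _ tkS dv cdv) => s.
  exact: (linf_norm_snd (derive1 u s, derive1 v s)).
- apply: le_trans (ler_normD _ _) _.
  rewrite -addn1 natrD mulrDl mul1r; apply: lerD => //.
  have tt : t k.+1 - t k = m%:R^-1 by rewrite tS; ring.
  have aw := area_le M0 sM (t0 k) tkS tk1.
  have ul : `|p.1| <= M * m%:R^-1.
    rewrite -tt; apply: (@lipschitz u M _ _ (t0 k) tkS tk1 du) => s s01.
    apply: le_trans (sM s s01).
    exact: (linf_norm_fst (derive1 u s, derive1 v s)).
  have vl : `|p.2| <= M * m%:R^-1.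
    rewrite -tt; apply: (@lipschitz v M _ _ (t0 k) tkS tk1 dv) => s s01.
    apply: le_trans (sM s s01).
    exact: (linf_norm_snd (derive1 u s, derive1 v s)).
  have pl : `|p.1 * p.2 / 2| <= M ^+ 2 / m%:R ^+ 2.
    rewrite !normrM (@ger0_norm _ 2^-1)//.
    have : `|p.1| * `|p.2| <= M ^+ 2 / m%:R ^+ 2.
      apply: le_trans (ler_pM _ _ ul vl) _ => //.
      by rewrite le_eqVlt; apply/orP; left; apply/eqP; field; rewrite gt_eqF.
    have : 0 <= `|p.1| * `|p.2| by rewrite mulr_ge0.
    lra.
  rewrite tt exprVn in aw.
  by rewrite (le_trans (ler_normB _ _))//; lra.
Qed.

End Path.

Lemma joins_word (e : R) x gs y : 0 < e -> joins x gs y -> exists om c,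
  [/\ y = (x * wend om * mk 0 0 c)%g,
      wlen om <= \sum_(g <- gs) cc_length (@linf_norm R) g & `|c| <= e].
Proof.
elim: gs x e => [|g gs IH] x e e0 /=.
  move=> <-; exists [::], 0; split.
  - by rewrite /= -mk_one !mulg1.
  - by rewrite /wlen !big_nil.
  - by rewrite normr0 ltW.
move=> [gh g0 /(IH _ (e / 2))]; rewrite divr_gt0// => /(_ isT).
move=> [om2 [c2 [yE l2 c2e]]].
have [|om1 [c1 [g1E l1 c1e]]] := horizontal_path_word gh (e := e / 2).
  by rewrite divr_gt0.
exists (om1 ++ om2), (c1 + c2); split.
- rewrite yE g1E g0 wend_cat; apply: heis_eqP; rewrite !heisE; ring.
- by rewrite wlen_cat big_cons lerD.
- by rewrite (le_trans (ler_normD _ _))//; lra.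
Qed.

(** * Words are piecewise horizontal paths *)

Lemma derive1n_horner (P : 'I_3 -> 'I_3 -> {poly R}) n :
  derive1n n (fun t : R => \matrix_(i < 3, j < 3) (P i j).[t]) =
  (fun t : R => \matrix_(i < 3, j < 3) (iter n deriv (P i j)).[t]).
Proof.
elim: n => [//|n IH]; rewrite /= -/(derive1n n _) IH; apply/funext => t.
rewrite derive1E derive_mx; last first.
  apply/derivable_mxP => i j.
  rewrite (_ : (fun x : R => _) = horner (iter n deriv (P i j))).
    exact: derivable_horner.
  by apply/funext => x; rewrite mxE.
apply/matrixP => i j; rewrite [LHS]mxE [RHS]mxE derivE derive1E.
congr ('D_1 _ t); apply/funext => x; exact: mxE.
Qed.

Lemma smooth_path_poly (g : R -> heis R) (P : 'I_3 -> 'I_3 -> {poly R}) :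
  (forall t i j, heis_mx (g t) i j = (P i j).[t]) -> smooth_path g.
Proof.
move=> gP n t.
have -> : (fun s => heis_mx (g s)) =
    (fun t : R => \matrix_(i < 3, j < 3) (P i j).[t]).
  by apply/funext => s; apply/matrixP => i j; rewrite mxE gP.
rewrite derive1n_horner; apply/derivable_mxP => i j.
rewrite (_ : (fun x : R => _) = horner (iter n deriv (P i j))).
  exact: derivable_horner.
by apply/funext => x; rewrite mxE.
Qed.

(** The left translate by [x] of the one-parameter subgroup tangent to [p]. *)
Definition segment (x : heis R) (p : R * R) (t : R) : heis R :=
  (x * hexp (t * p.1, t * p.2)%R)%g.

Lemma segmentE x p t : segment x p t =
  mk (hu x + t * p.1) (hv x + t * p.2)
     (hw x + t * (hu x * p.2) + t ^+ 2 * (p.1 * p.2 / 2)).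
Proof. by apply: heis_eqP; rewrite /segment /hexp !heisE //=; ring. Qed.

Definition segment_poly x p : 'M[{poly R}]_3 :=
  heis_mat ((hu x)%:P + p.1%:P * 'X) ((hv x)%:P + p.2%:P * 'X)
    ((hw x)%:P + (hu x * p.2)%:P * 'X + (p.1 * p.2 / 2)%:P * 'X^2).

Lemma segment_polyE x p : (fun t => heis_mx (segment x p t)) =
  (fun t => \matrix_(i < 3, j < 3) (segment_poly x p i j).[t]).
Proof.
apply/funext => t; rewrite segmentE; apply/matrixP => i j; rewrite !mxE /=.
case: i j => -[|[|[|//]]] ? [[|[|[|//]]] ?] /=;
  rewrite ?(hornerD, hornerM, hornerC, hornerX, hornerXn)//; ring.
Qed.

Lemma segment_smooth x p : smooth_path (segment x p).
Proof.
by apply: (@smooth_path_poly _ (segment_poly x p)) => t i j;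
  rewrite -[LHS]/((fun t => heis_mx (segment x p t)) t i j) segment_polyE mxE.
Qed.

Lemma segment_velocity x p t :
  velocity (segment x p) t = p.1 *: delta_mx 0 1 + p.2 *: delta_mx 1 2.
Proof.
rewrite /velocity segment_polyE.
rewrite -[derive1 _]/(derive1n 1 _) derive1n_horner.
have d1 : deriv (1 : {poly R}) = 0 by rewrite -polyC1 derivC.
have -> : heis_mx ((segment x p t)^-1)%g =
    heis_mat (- (hu x + t * p.1)) (- (hv x + t * p.2))
     ((hu x + t * p.1) * (hv x + t * p.2) -
       (hw x + t * (hu x * p.2) + t ^+ 2 * (p.1 * p.2 / 2))).
  by rewrite segmentE mk_inv.
apply/matrixP => i j; rewrite !mxE !big_ord_recl big_ord0 !mxE.
case: i j => -[|[|[|//]]] ? [[|[|[|//]]] ?] /=;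
  rewrite ?(derivD, derivM, derivC, derivX, derivXn, deriv0, d1) /=;
  rewrite ?(hornerD, hornerM, hornerMn, hornerC, hornerX, hornerXn, horner0) /=;
  by field.
Qed.

Lemma cc_length_segment x p :
  cc_length (@linf_norm R) (segment x p) = linf_norm p.
Proof.
transitivity (\int[@lebesgue_measure R]_(t in `[0, 1]) linf_norm p); last first.
  rewrite Rintegral_cst//; have := @lebesgue_measure_itv R `[0, 1].
  rewrite /= => ->; rewrite /= lte_fin ltr01.
  by rewrite oppr0 addr0 mulr1.
apply: eq_Rintegral => t _.
rewrite segment_velocity !mxE /= !(mulr1, mulr0, addr0, add0r).
by case: p.
Qed.

Lemma segment_horizontal x p : horizontal_path (segment x p).
Proof.
split; first exact: (@segment_smooth x p).
by move=> t _; rewrite segment_velocity horizontal_spaceI.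
Qed.

Lemma word_joins x om : exists gs,
  joins x gs (x * wend om)%g /\
  \sum_(g <- gs) cc_length (@linf_norm R) g = wlen om.
Proof.
elim: om x => [|p om IH] x.
  by exists [::]; rewrite /= mulg1 /wlen !big_nil.
have [gs [jgs lgs]] := IH (x * hexp p)%g.
exists (segment x p :: gs); split; last first.
  by rewrite big_cons wlen_cons lgs cc_length_segment.
split; first exact: segment_horizontal.
- by apply: heis_eqP; rewrite /segment /hexp !heisE /=; ring.
- rewrite /= mulgA; suff -> : segment x p 1 = (x * hexp p)%g by [].
  by rewrite /segment !mul1r -surjective_pairing.
Qed.

(** * The metric as an infimum over words *)

Let d := cc_dist (@linf_norm R).

Lemma cc_length_ge0 g : 0 <= cc_length (@linf_norm R) g.
Proof. by apply: Rintegral_ge0 => t _; exact: linf_norm_ge0. Qed.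

Lemma cc_dist_le_word x om : d x (x * wend om)%g <= wlen om.
Proof.
have [gs [jgs <-]] := word_joins x om.
apply: ge_inf; last by exists gs.
exists 0 => _ [hs _ <-]; apply: sumr_ge0 => g _; exact: cc_length_ge0.
Qed.

(** The metric is the infimum of the lengths of words: a piecewise horizontal
    path is approximated by words up to an arbitrarily small central error,
    which costs an arbitrarily short commutator to correct. *)
Lemma cc_dist_lt_word x y r : d x y < r ->
  exists2 om, wend om = (x^-1 * y)%g & wlen om < r.
Proof.
move=> dr; have [_ [gs jgs <-] lr] : exists2 l,
    [set \sum_(g <- gs) cc_length (@linf_norm R) g |
      gs in [set gs | joins x gs y]] l & l < r.
  apply: inf_lt dr.
  have [om [omE _]] := point_word (hu (x^-1 * y)%g) (hv (x^-1 * y)%g)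
      (hw (x^-1 * y)%g).
  have [gs [jgs _]] := word_joins x om.
  by eexists; exists gs; [move: jgs; rewrite omE -mk_eta mulgA mulgV mul1g|].
set l := \sum_(g <- gs) _ in lr.
pose e := ((r - l) / 8) ^+ 2.
have e0 : 0 < e by rewrite exprn_gt0// divr_gt0// subr_gt0.
have [om [c [yE oml ce]]] := joins_word e0 jgs.
have [om' [omE' oml']] := central_word c.
exists (om ++ om').
  by rewrite yE wend_cat omE' !mulgA mulVg mul1g.
rewrite wlen_cat oml'.
have : Num.sqrt `|c| <= (r - l) / 8.
  rewrite -(@ger0_norm _ ((r - l) / 8)) ?divr_ge0 ?subr_ge0 ?(ltW lr)//.
  by rewrite -(sqrtr_sqr ((r - l) / 8)) ler_wsqrtr.
rewrite -/l in oml; lra.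
Qed.

End HorizontalPaths.

(** * The Carnot-Caratheodory norm *)

Section Norm.
Context (R : realType).
Implicit Types (x y g h : heis R).
Notation d := (cc_dist (@linf_norm R)).

Definition ccn g : R := d 1%g g.

Lemma ccn_le_word om : ccn (wend om) <= wlen om.
Proof. by have := cc_dist_le_word 1%g om; rewrite mul1g. Qed.

Lemma ccn_lt_word g r : ccn g < r -> exists2 om, wend om = g & wlen om < r.
Proof. by move=> /cc_dist_lt_word[om]; rewrite invg1 mul1g; exists om. Qed.

Lemma cc_distE x y : d x y = ccn (x^-1 * y)%g.
Proof.
apply/eqP; rewrite eq_le !leNgt; apply/andP; split; apply/negP.
  move=> /ccn_lt_word[om omE]; rewrite ltNge => /negP; apply.
  by have := cc_dist_le_word x om; rewrite omE mulgA mulgV mul1g.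
move=> /cc_dist_lt_word[om omE]; rewrite ltNge => /negP; apply.
by rewrite -omE ccn_le_word.
Qed.

Lemma ccn_ge0 g : 0 <= ccn g.
Proof.
rewrite leNgt; apply/negP => /ccn_lt_word[om _].
by rewrite ltNge wlen_ge0.
Qed.

Lemma ccn1 : ccn 1%g = 0.
Proof.
apply/eqP; rewrite eq_le ccn_ge0 andbT.
by have := ccn_le_word [::]; rewrite /wlen big_nil.
Qed.

Lemma ccnM g h : ccn (g * h)%g <= ccn g + ccn h.
Proof.
rewrite leNgt; apply/negP => lt.
pose e := (ccn (g * h)%g - (ccn g + ccn h)) / 2.
have e0 : 0 < e by rewrite divr_gt0// subr_gt0.
have [|om omE oml] := @ccn_lt_word g (ccn g + e); first by rewrite ltrDl.
have [|om' omE' oml'] := @ccn_lt_word h (ccn h + e); first by rewrite ltrDl.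
have := ccn_le_word (om ++ om').
rewrite wend_cat omE omE' wlen_cat /e in oml oml' *; lra.
Qed.

Let ccnV_le g : ccn g^-1%g <= ccn g.
Proof.
rewrite leNgt; apply/negP => /ccn_lt_word[om omE].
by rewrite ltNge -wlen_rev -omE -wend_rev ccn_le_word.
Qed.

Lemma ccnV g : ccn g^-1%g = ccn g.
Proof.
by apply/eqP; rewrite eq_le ccnV_le -{1}(invgK g) ccnV_le.
Qed.

Let ccn_dil_le t g : 0 < t -> ccn (dil t g) <= t * ccn g.
Proof.
move=> t0; rewrite leNgt; apply/negP; rewrite mulrC -ltr_pdivlMr//.
move=> /ccn_lt_word[om omE]; rewrite ltr_pdivlMr// mulrC ltNge => /negP; apply.
have := ccn_le_word (wdil t om).
by rewrite wend_dil wlen_dil omE ger0_norm// ltW.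
Qed.

Lemma ccn_dil t g : 0 < t -> ccn (dil t g) = t * ccn g.
Proof.
move=> t0; apply/eqP; rewrite eq_le ccn_dil_le//=.
rewrite -ler_pdivlMl//; apply: le_trans (ccn_dil_le _ _); rewrite ?invr_gt0//.
by rewrite dil_dil mulVf ?gt_eqF// dil1.
Qed.

Lemma ccn_hu g : `|hu g| <= ccn g.
Proof.
rewrite leNgt; apply/negP => /ccn_lt_word[om <-].
by rewrite ltNge wend_hu.
Qed.

Lemma ccn_hv g : `|hv g| <= ccn g.
Proof.
rewrite leNgt; apply/negP => /ccn_lt_word[om <-].
by rewrite ltNge wend_hv.
Qed.

Lemma ccn_area g : `|hw g - hu g * hv g / 2| <= ccn g ^+ 2.
Proof.
rewrite leNgt; apply/negP; set A := Num.norm _ => lt.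
have A0 : 0 <= A by rewrite normr_ge0.
have /ccn_lt_word[om omE oml] : ccn g < Num.sqrt A.
  by rewrite -(ger0_norm (ccn_ge0 g)) -sqrtr_sqr ltr_sqrt// (le_lt_trans _ lt)// sqr_ge0.
have := wend_area om; rewrite omE -/A leNgt => /negP; apply.
by rewrite -[ltRHS](sqr_sqrtr A0) ltr_pXn2r// nnegrE ?wlen_ge0// sqrtr_ge0.
Qed.

(** Together with [ccn_hu], [ccn_hv] and [ccn_le], this compares the norm with
    [max (|u|, |v|, sqrt |w|)]. *)
Lemma ccn_hw g : `|hw g| <= 2 * ccn g ^+ 2.
Proof.
have := ccn_area g; have := ccn_hu g; have := ccn_hv g.
set a := ccn g; set A := Num.norm (hw g - _) => va ua Aa.
have uv : `|hu g * hv g / 2| <= a ^+ 2 / 2.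
  rewrite normrM normrM [X in _ * X]ger0_norm// ler_pM2r// expr2.
  exact: ler_pM.
have : `|hw g| <= A + `|hu g * hv g / 2|.
  by rewrite -{1}(subrK (hu g * hv g / 2) (hw g)) ler_normD.
have : 0 <= a ^+ 2 by rewrite sqr_ge0.
lra.
Qed.

Lemma ccn_le g : ccn g <= `|hu g| + `|hv g| + 4 * Num.sqrt `|hw g|.
Proof.
have [om [omE <-]] := point_word (hu g) (hv g) (hw g).
by rewrite {1}(mk_eta g) -omE ccn_le_word.
Qed.

Lemma ccn_eq0 g : ccn g = 0 -> g = 1%g.
Proof.
move=> g0; have u0 := ccn_hu g; have v0 := ccn_hv g; have w0 := ccn_hw g.
rewrite g0 ?expr0n ?mulr0 !normr_le0 in u0 v0 w0.
by apply: heis_eqP; rewrite !heisE; apply/eqP.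
Qed.

Lemma cc_dist_metric : is_metric d.
Proof.
split.
- by move=> x; rewrite cc_distE mulVg ccn1.
- move=> x y; rewrite cc_distE => /ccn_eq0 xy.
  by have := mulVKg x y; rewrite xy mulg1.
- by move=> x y; rewrite !cc_distE -ccnV invgM invgK.
- move=> y x z; rewrite !cc_distE.
  have -> : (x^-1 * z = (x^-1 * y) * (y^-1 * z))%g by rewrite -mulgA mulVKg.
  exact: ccnM.
Qed.

(** * Closed balls are compact *)

Definition heis_point (p : R * R * R) : metrized cc_dist_metric :=
  mk p.1.1 p.1.2 p.2.

(** Near [p] the distance to [heis_point p] is bounded by a continuous function
    of the coordinates that vanishes at [p]. *)
Lemma heis_point_continuous : continuous heis_point.
Proof.
move=> p; apply/cvg_ballP => e e0.
pose F (q : R * R * R) : R := `|q.1.1 - p.1.1| + `|q.1.2 - p.1.2| +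
  4 * Num.sqrt `|q.2 - p.2 - p.1.1 * (q.1.2 - p.1.2)|.
have cF : F q @[q --> p] --> F p.
  have c1 : q.1.1 @[q --> p] --> p.1.1.
    apply: (@cvg_comp _ _ _ fst fst); [exact: cvg_fst|exact: cvg_fst].
  have c2 : q.1.2 @[q --> p] --> p.1.2.
    apply: (@cvg_comp _ _ _ fst snd); [exact: cvg_fst|exact: cvg_snd].
  have c3 : q.2 @[q --> p] --> p.2 by exact: cvg_snd.
  have c11 : `|q.1.1 - p.1.1| @[q --> p] --> `|p.1.1 - p.1.1|.
    apply: (@cvg_norm R R^o); apply: (@cvgB R R^o) => //; exact: cvg_cst.
  have c22 : q.1.2 - p.1.2 @[q --> p] --> p.1.2 - p.1.2.
    by apply: (@cvgB R R^o) => //; exact: cvg_cst.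
  have c33 : q.2 - p.2 @[q --> p] --> p.2 - p.2.
    by apply: (@cvgB R R^o) => //; exact: cvg_cst.
  apply: (@cvgD R R^o).
    apply: (@cvgD R R^o) => //.
    exact: (@cvg_norm R R^o).
  apply: (@cvgM R); first exact: cvg_cst.
  apply: (@cvg_comp _ _ _ _ Num.sqrt); last exact: sqrt_continuous.
  apply: (@cvg_norm R R^o); apply: (@cvgB R R^o) => //.
  by apply: (@cvgM R); [exact: cvg_cst|exact: c22].
have Fp : F p = 0.
  by rewrite /F !subrr mulr0 subr0 normr0 sqrtr0; ring.
have : \forall q \near p, F q < e.
  by apply: (@cvgr_lt R _ _ _ F (F p) cF); rewrite Fp.
apply: filterS => q qe; rewrite ballEmdist /=.
apply: le_lt_trans qe; rewrite -[leLHS]/(d _ _) cc_distE.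
apply: le_trans (ccn_le _) _; rewrite /heis_point !heisE /F.
rewrite le_eqVlt; apply/orP; left; apply/eqP.
by congr (_ + _ + _ * Num.sqrt _); congr (Num.norm _); ring.
Qed.

(** The coordinates are bounded on a ball, which is therefore a closed subset of
    the continuous image of a compact box. *)
Lemma compact_cball (r : R) : compact_metric d (cball d 1%g r).
Proof.
exists cc_dist_metric.
pose B : set (R * R * R) := (`[- r, r] `*` `[- r, r]) `*`
  `[- (2 * r ^+ 2), 2 * r ^+ 2].
apply: (@subclosed_compact _ _ (heis_point @` B)).
- move=> x clx; apply/ler_addgt0Pr => e e0.
  have [y [yr /=]] := clx _ (@nbhsx_ballx _ (metrized cc_dist_metric) x e e0).
  rewrite ballEmdist /= => xy.
  apply: le_trans (is_metric_tri cc_dist_metric y _ _) _.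
  by rewrite lerD// ltW// (is_metric_sym cc_dist_metric).
- apply: continuous_compact; first exact/continuous_subspaceT/heis_point_continuous.
  by apply: compact_setX; [apply: compact_setX|]; exact: segment_compact.
- move=> x xr; exists (hu x, hv x, hw x); last first.
    by rewrite /heis_point -mk_eta.
  have {}xr : ccn x <= r by [].
  have r0 : 0 <= r by apply: le_trans xr; exact: ccn_ge0.
  split; [split|]; rewrite /= in_itv /= -ler_norml.
  + exact: le_trans (ccn_hu x) xr.
  + exact: le_trans (ccn_hv x) xr.
  + apply: le_trans (ccn_hw x) _; rewrite ler_wpM2l// ler_pXn2r// nnegrE//.
    exact: ccn_ge0.
Qed.

End Norm.

Lemma finite_compact_metric (R : realType) (T : choiceType) (d : T -> T -> R)
  (A : set T) : is_metric d -> finite_set A -> compact_metric d A.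
Proof. by move=> dP fA; exists dP; exact: finite_compact. Qed.

(** * Word metrics *)

Section WordMetric.
Context (G : groupType).
Implicit Types (S : {fset G}) (x y : G).

Lemma fset_powSP S n x : reflect
  (exists a s, [/\ a \in fset_pow S n, s \in S & x = (a * s)%g])
  (x \in fset_pow S n.+1).
Proof.
apply: (iffP idP) => [/imfset2P[a aS [s sS ->]]|[a [s [aS sS ->]]]].
  by exists a, s.
by apply/imfset2P; exists a => //; exists s.
Qed.

Lemma fset_pow0 S : fset_pow S 0 = [fset 1%g]%fset. Proof. by []. Qed.

Lemma fset_powD S m n x y :
  x \in fset_pow S m -> y \in fset_pow S n -> (x * y)%g \in fset_pow S (m + n).
Proof.
move=> xm; elim: n y => [|n IH] y.
  by rewrite fset_pow0 inE => /eqP ->; rewrite mulg1 addn0.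
move=> /fset_powSP[a [s [an sS ->]]]; rewrite addnS; apply/fset_powSP.
by exists (x * a)%g, s; split => //; [exact: IH|rewrite mulgA].
Qed.

Lemma fset_pow1 S s : s \in S -> s \in fset_pow S 1.
Proof.
by move=> sS; apply/fset_powSP; exists 1%g, s; rewrite fset_pow0 inE mul1g.
Qed.

Lemma fset_powV S n x : symmetric_fset S ->
  x \in fset_pow S n -> (x^-1)%g \in fset_pow S n.
Proof.
move=> Ssym; elim: n x => [|n IH] x.
  by rewrite fset_pow0 !inE => /eqP ->; rewrite invg1.
move=> /fset_powSP[a [s [an sS ->]]]; rewrite invgM -add1n.
by apply: fset_powD; [apply: fset_pow1; exact: Ssym|exact: IH].
Qed.

Lemma generating_pow S x : symmetric_fset S -> generating_fset S ->
  exists n, x \in fset_pow S n.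
Proof.
move=> Ssym Sgen; apply: (Sgen [set x | exists n, x \in fset_pow S n]) => /=.
- by exists 0%N; rewrite fset_pow0 inE.
- by move=> a b [m am] [n bn]; exists (m + n)%N; exact: fset_powD.
- by move=> a [n an]; exists n; exact: fset_powV.
- by move=> s sS; exists 1%N; exact: fset_pow1.
Qed.

Context (R : realType).

Lemma word_dist_le S x y k :
  (x^-1 * y)%g \in fset_pow S k -> word_dist R S x y <= k%:R.
Proof.
by move=> xyk; apply: ge_inf; [exists 0 => _ [j _ <-]|exists k].
Qed.

Section Metric.
Variables (S : {fset G}) (Ssym : symmetric_fset S) (Sgen : generating_fset S).

(** The word lengths are natural numbers, so that their infimum is one of them. *)
Lemma word_dist_attained x y : exists k,
  word_dist R S x y = k%:R /\ (x^-1 * y)%g \in fset_pow S k.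
Proof.
have ex := generating_pow (x^-1 * y)%g Ssym Sgen.
case: (ex_minnP ex) => k xyk kmin; exists k; split=> //.
apply/eqP; rewrite eq_le word_dist_le//=; apply: lb_le_inf.
  by exists k%:R; exists k.
by move=> _ [j /= xyj <-]; rewrite ler_nat kmin.
Qed.

Lemma word_metric (c : R) : 0 < c ->
  is_metric (fun x y => word_dist R S x y / c).
Proof.
move=> c0; have dge0 x y : 0 <= word_dist R S x y.
  by have [k [-> _]] := word_dist_attained x y.
have dV x y : word_dist R S y x <= word_dist R S x y.
  have [k [-> xyk]] := word_dist_attained x y; apply: word_dist_le.
  by have := fset_powV Ssym xyk; rewrite invgM invgK.
split.
- move=> x; suff -> : word_dist R S x x = 0 by rewrite mul0r.
  apply/eqP; rewrite eq_le dge0 andbT; apply: (@word_dist_le _ _ _ 0).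
  by rewrite mulVg fset_pow0 inE.
- move=> x y /eqP; rewrite mulf_eq0 invr_eq0 (gt_eqF c0) orbF => /eqP d0.
  have [k [dk]] := word_dist_attained x y.
  move: dk; rewrite d0 => /eqP; rewrite eq_sym pnatr_eq0 => /eqP ->.
  rewrite fset_pow0 inE => /eqP xy.
  by have := mulVKg x y; rewrite xy mulg1.
- by move=> x y; congr (_ / _); apply/eqP; rewrite eq_le !dV.
- move=> y x z; rewrite -mulrDl ler_pM2r ?invr_gt0//.
  have [k [-> xyk]] := word_dist_attained x y.
  have [l [-> yzl]] := word_dist_attained y z.
  rewrite -natrD; apply: word_dist_le.
  have -> : (x^-1 * z = (x^-1 * y) * (y^-1 * z))%g by rewrite -mulgA mulVKg.
  exact: fset_powD.
Qed.

Lemma word_ball_finite (c r : R) (x : G) : 0 < c ->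
  finite_set (cball (fun x y => word_dist R S x y / c) x r).
Proof.
move=> c0; pose N := Num.truncn (r * c).
apply: (@sub_finite_set _ _
  (\bigcup_(k in `I_N.+1) [set` [fset (x * g)%g | g in fset_pow S k]%fset])).
  move=> y; rewrite /cball /= ler_pdivrMr//.
  have [k [-> xyk]] := word_dist_attained x y => kr.
  exists k; first by rewrite /= ltnS truncn_ge_nat// (le_trans _ kr).
  by apply/imfsetP; exists (x^-1 * y)%g => //; rewrite mulVKg.
apply: bigcup_finite; first exact: finite_II.
by move=> k _; exact: finite_fset.
Qed.

End Metric.
End WordMetric.

(** * The generating sets *)

Definition heis_box (A B C : nat) : {fset heis int} :=
  [fset mk ((nat_of_ord p.1.1)%:Z - A%:Z)%R ((nat_of_ord p.1.2)%:Z - B%:Z)%R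
     ((nat_of_ord p.2)%:Z - C%:Z)%R |
   p in {: 'I_(A + A).+1 * 'I_(B + B).+1 * 'I_(C + C).+1}]%fset.

Lemma centered_ord M (z : int) : `|z| <= M%:Z ->
  exists i : 'I_(M + M).+1, z = (nat_of_ord i)%:Z - M%:Z.
Proof.
move=> zM; have lt : (absz (z + M%:Z)%R < (M + M).+1)%N by lia.
by exists (Ordinal lt) => /=; lia.
Qed.

Lemma in_heis_box A B C (x : heis int) : (x \in heis_box A B C) =
  [&& `|hu x| <= A%:Z, `|hv x| <= B%:Z & `|hw x| <= C%:Z].
Proof.
apply/imfsetP/idP => [[[[i j] k] _ ->] /=|/and3P[uA vB wC]].
  rewrite !heisE.
  by have := ltn_ord i; have := ltn_ord j; have := ltn_ord k; lia.
have [i ui] := centered_ord uA; have [j vj] := centered_ord vB.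
have [k wk] := centered_ord wC.
by exists (i, j, k) => //=; rewrite -ui -vj -wk -mk_eta.
Qed.

Lemma card_heis_box A B C :
  (#|` heis_box A B C| <= (A + A + 1) * (B + B + 1) * (C + C + 1))%N.
Proof.
apply: leq_trans (leq_imfset_card _ _ _) _.
by rewrite -cardE !card_prod !card_ord !addn1.
Qed.

(** The condition on the third coordinate bounds it up to the area [u v / 2],
    which makes it invariant under inversion. *)
Definition heis_gen (a W : nat) : {fset heis int} :=
  [fset x in heis_box a a (a * a + W) | `|2 * hw x - hu x * hv x| <= 2 * W%:Z]%fset.

Lemma in_heis_gen a W (x : heis int) : (x \in heis_gen a W) =
  [&& `|hu x| <= a%:Z, `|hv x| <= a%:Z &
      `|2 * hw x - hu x * hv x| <= 2 * W%:Z].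
Proof.
rewrite !inE /= in_heis_box.
case ua : (`|hu x| <= a%:Z) => //; case va : (`|hv x| <= a%:Z) => //=.
apply: andb_idl => wW.
have uv : `|hu x * hv x| <= (a * a)%:Z by rewrite normrM PoszM ler_pM.
lia.
Qed.

Lemma heis_gen_sym a W : symmetric_fset (heis_gen a W).
Proof.
move=> x; rewrite !in_heis_gen !heisE !normrN => /and3P[-> -> /=].
by rewrite -normrN; congr (is_true (Num.norm _ <= _)); ring.
Qed.

Lemma heis_gen_generating a W : (0 < a)%N -> (0 < W)%N ->
  generating_fset (heis_gen a W).
Proof.
move=> a0 W0 H H1 HM HV HS x.
have pow (f : int -> heis int) : f 0 = 1%g ->
    (forall i j, f (i + j) = (f i * f j)%g) -> H (f 1) -> forall z, H (f z).
  move=> f0 fD Hf; elim/int_ind => [|n IH|n IH].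
  - by rewrite f0.
  - by rewrite -addn1 PoszD fD; exact: HM.
  - have fN : f (-1) = ((f 1%R)^-1)%g.
      by apply: (@mulgI _ (f 1)); rewrite mulgV -fD subrr f0.
    rewrite -addn1 PoszD opprD fD fN; apply: HM => //; exact: HV.
have Hu z : H (mk z 0 0).
  apply: (pow (fun z => mk z 0 0)) => //.
  - by rewrite mk_one.
  - by move=> i j; rewrite mk_mul; congr mk; ring.
  - by apply: HS; rewrite in_heis_gen !heisE; lia.
have Hv z : H (mk 0 z 0).
  apply: (pow (fun z => mk 0 z 0)) => //.
  - by rewrite mk_one.
  - by move=> i j; rewrite mk_mul; congr mk; ring.
  - by apply: HS; rewrite in_heis_gen !heisE; lia.
have Hw z : H (mk 0 0 z).
  apply: (pow (fun z => mk 0 0 z)) => //.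
  - by rewrite mk_one.
  - by move=> i j; rewrite mk_mul; congr mk; ring.
  - by apply: HS; rewrite in_heis_gen !heisE; lia.
have -> : x = (mk 0 (hv x) 0 * mk (hu x) 0 0 * mk 0 0 (hw x))%g.
  by apply: heis_eqP; rewrite !heisE; ring.
by apply: (HM) => //; apply: (HM).
Qed.

(** Each pair [(u, v)] with nonnegative entries below [a] extends to [W]
    elements of the generating set, whose third coordinates start at the
    integer part of [u v / 2]. *)
Lemma card_heis_gen a W : (a * a * W <= #|` heis_gen a W|)%N.
Proof.
pose f (p : 'I_a * 'I_a * 'I_W) : heis int :=
  mk (p.1.1 : nat)%:Z (p.1.2 : nat)%:Z ((p.1.1 * p.1.2)./2 + p.2)%:Z.
have finj : injective f.
  move=> [[i j] k] [[i' j'] k'] /= fE.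
  have := congr1 (@hu _) fE; have := congr1 (@hv _) fE; have := congr1 (@hw _) fE.
  rewrite /f !heisE /= => kk [jj] [ii].
  move/val_inj: ii kk => ->; move/val_inj: jj => -> [/addnI/val_inj ->].
  by [].
have -> : (a * a * W)%N = #|` [fset f p | p in {: 'I_a * 'I_a * 'I_W}]%fset|.
  by rewrite card_imfset// -cardE !card_prod !card_ord.
apply/fsubset_leq_card/fsubsetP => _ /imfsetP[[[i j] k] _ ->].
rewrite in_heis_gen /f !heisE /=.
have := ltn_ord i; have := ltn_ord j; have := ltn_ord k => kW ja ia.
have := odd_double_half (i * j); rewrite -mul2n; case: (odd _) => /= ijE; lia.
Qed.

Lemma heis_gen_pow_box a W n : (fset_pow (heis_gen a W) n `<=`
  heis_box (n * a) (n * a) (n * (a * a + W) + n * n * (a * a)))%fset.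
Proof.
elim: n => [|n IH]; apply/fsubsetP => x.
  by rewrite fset_pow0 inE => /eqP ->; rewrite in_heis_box !heisE.
move=> /fset_powSP[y [s [/(fsubsetP IH)]]].
rewrite in_heis_box => /and3P[yu yv yw]; rewrite !inE /= in_heis_box.
move=> /andP[/and3P[su sv sw] _] ->; rewrite in_heis_box !heisE.
have ysw : `|hu y * hv s| <= (n * (a * a))%:Z.
  by rewrite normrM mulnA PoszM ler_pM.
lia.
Qed.

(** * Comparing the word norm with the Carnot-Caratheodory norm *)

Section Compare.
Context (R : realType).
Notation ccn := (@ccn R).

Definition emb (x : heis int) : heis R :=
  mk (hu x)%:~R (hv x)%:~R (hw x)%:~R.

Definition flo (P : heis R) : heis int :=
  mk (Num.floor (hu P)) (Num.floor (hv P)) (Num.floor (hw P)).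

Lemma embM x y : emb (x * y)%g = (emb x * emb y)%g.
Proof. by apply: heis_eqP; rewrite /emb !heisE !rmorphD ?rmorphM. Qed.

Lemma emb1 : emb 1%g = 1%g.
Proof. by apply: heis_eqP; rewrite /emb !heisE. Qed.

Lemma embV x : emb x^-1%g = ((emb x)^-1)%g.
Proof. by apply: heis_eqP; rewrite /emb !heisE ?rmorphB ?rmorphM ?rmorphN. Qed.

Lemma embK x : flo (emb x) = x.
Proof. by apply: heis_eqP; rewrite /flo /emb !heisE intrKfloor. Qed.

(** A generator differs from the exponential of its first two coordinates by a
    central factor of size at most [W]; these factors can be moved to the end. *)
Lemma heis_gen_pow_word a W k x : x \in fset_pow (heis_gen a W) k ->
  exists om c, [/\ emb x = (wend om * mk 0 0 c)%g,
    wlen om <= k%:R * a%:R & `|c| <= k%:R * W%:R].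
Proof.
elim: k x => [|k IH] x.
  rewrite fset_pow0 inE => /eqP ->; exists [::], 0; split.
  - by rewrite emb1 /= -mk_one mulg1.
  - by rewrite /wlen big_nil mul0r.
  - by rewrite normr0 mul0r.
move=> /fset_powSP[y [s [/IH[om [c [yE oml cl]]] sS ->]]].
move: sS; rewrite in_heis_gen => /and3P[su sv sw].
pose p : R * R := ((hu s)%:~R, (hv s)%:~R).
pose c' : R := (hw s)%:~R - p.1 * p.2 / 2.
exists (om ++ [:: p]), (c + c'); split.
- rewrite embM yE wend_cat; apply: heis_eqP; rewrite /= /emb /hexp !heisE /c' /=;
    ring.
- rewrite wlen_cat wlen1 -addn1 natrD mulrDl mul1r lerD// /linf_norm ge_max /=.
  rewrite -!intr_norm !pmulrn !ler_int; exact/andP.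
- rewrite -addn1 natrD mulrDl mul1r (le_trans (ler_normD _ _))// lerD//.
  have -> : c' = (2 * hw s - hu s * hv s)%:~R / 2.
    by rewrite /c' /p /= rmorphB !rmorphM /=; field.
  rewrite normrM [X in _ * X]ger0_norm// ler_pdivrMr// -intr_norm.
  by rewrite [W%:R * 2]mulrC; move: sw; rewrite -(ler_int R) [in leRHS]rmorphM.
Qed.

Lemma floor_frac (x : R) : 0 <= x - (Num.floor x)%:~R <= 1.
Proof.
have /andP[] := floor_itv x; rewrite intrD => ? ?.
by apply/andP; split; lra.
Qed.

Definition psi (m : nat) (x : heis int) : heis R := dil (m%:R ^- 2) (emb x).

Lemma psiM m x y : psi m (x * y)%g = (psi m x * psi m y)%g.
Proof. by rewrite /psi embM dilM. Qed.

Lemma psiV m x : psi m x^-1%g = ((psi m x)^-1)%g.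
Proof. by rewrite /psi embV dilV. Qed.

Section Fixed.
Variables (m W : nat) (m0 : (0 < m)%N) (W0 : (0 < W)%N).
Let S := heis_gen m W.
Let wd x y : R := word_dist R S x y / m%:R.
Let q : R := W%:R / m%:R ^+ 3.

Let mR0 : 0 < m%:R :> R. Proof. by rewrite ltr0n. Qed.

(** A central element of size [c] has norm of the order of [sqrt c], hence the
    additive error. *)
Lemma ccn_psi_le x y :
  cc_dist (@linf_norm R) (psi m x) (psi m y) <=
    wd x y + 4 * Num.sqrt (wd x y * q).
Proof.
rewrite cc_distE -psiV -psiM /wd.
have [k [-> xyk]] := word_dist_attained R
  (@heis_gen_sym m W) (heis_gen_generating m0 W0) x y.
have [om [c [xyE oml cl]]] := heis_gen_pow_word xyk.
have m20 : 0 < m%:R ^- 2 :> R by rewrite invr_gt0 exprn_gt0.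
rewrite /psi ccn_dil// xyE.
have cle : ccn (wend om * mk 0 0 c)%g <=
    k%:R * m%:R + 4 * Num.sqrt (k%:R * W%:R).
  apply: le_trans (ccnM _ _) _; apply: lerD.
    exact: le_trans (ccn_le_word om) oml.
  apply: le_trans (ccn_le _) _; rewrite !heisE normr0 !add0r.
  by rewrite ler_wpM2l// ler_wsqrtr.
apply: le_trans (ler_wpM2l (ltW m20) cle) _.
have -> : k%:R / m%:R * q = (m%:R ^- 2) ^+ 2 * (k%:R * W%:R).
  by rewrite /q; field; rewrite gt_eqF.
rewrite (@sqrtrM _ ((m%:R ^- 2) ^+ 2)) ?sqr_ge0// sqrtr_sqr ger0_norm ?(ltW m20)//.
rewrite le_eqVlt; apply/orP; left; apply/eqP; field.
by rewrite gt_eqF.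
Qed.

Let floor_step (x y : R) : `|y| <= m%:R ->
  `|- Num.floor x + Num.floor (x + y)| <= m%:Z.
Proof.
rewrite ler_norml => /andP[y1 y2].
have /andP[x1 x2] := floor_itv x; have /andP[xy1 xy2] := floor_itv (x + y).
rewrite intrD in x2 xy2.
have h1 : Num.floor (x + y) < Num.floor x + m%:Z + 1.
  by rewrite -(ltr_int R) !intrD; lra.
have h2 : Num.floor x < Num.floor (x + y) + m%:Z + 1.
  by rewrite -(ltr_int R) !intrD; lra.
lia.
Qed.

(** The coordinates [u] and [v] move by at most [m] along the path, and so do
    their integer parts because [m] is an integer. Rounding them perturbs the
    increment of the third coordinate by at most the size of [u] plus [m], which
    the width [W] absorbs. *)
Lemma floor_word_step (P : heis R) om K : wlen om <= m%:R ->
  `|hu P| <= K * m%:R ^+ 2 -> (5 + K) * m%:R ^+ 2 <= W%:R ->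
  ((flo P)^-1 * flo (P * wend om))%g \in S.
Proof.
move=> oml uP KW; rewrite in_heis_gen.
have au := le_trans (wend_hu om) oml; have av := le_trans (wend_hv om) oml.
have aw : `|hw (wend om) - hu (wend om) * hv (wend om) / 2| <= m%:R ^+ 2.
  by apply: le_trans (wend_area om) _; rewrite ler_pXn2r// nnegrE// wlen_ge0.
rewrite /flo !heisE; move: au av aw uP.
set u := hu P; set v := hv P; set w := hw P.
set a := hu _; set b := hv _; set c := hw _ => au av aw uP.
have fu := floor_step u au; have fv := floor_step v av.
rewrite fu fv /=.
rewrite -(ler_int R) intr_norm.
have /andP[u1 u2] := floor_frac u; have /andP[v1 v2] := floor_frac v.
have /andP[ua1 ua2] := floor_frac (u + a); have /andP[vb1 vb2] := floor_frac (v + b).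
have /andP[w1 w2] := floor_frac w; have /andP[wc1 wc2] := floor_frac (w + c + u * b).
have fuR : `|- (Num.floor u)%:~R + (Num.floor (u + a))%:~R| <= m%:R :> R.
  by rewrite -rmorphN -intrD -intr_norm pmulrn ler_int.
have fvR : `|- (Num.floor v)%:~R + (Num.floor (v + b))%:~R| <= m%:R :> R.
  by rewrite -rmorphN -intrD -intr_norm pmulrn ler_int.
rewrite !(rmorphB, rmorphD, rmorphM, rmorphN) /=.
move: u1 u2 v1 v2 ua1 ua2 vb1 vb2 w1 w2 wc1 wc2 fuR fvR.
set U : R := (Num.floor u)%:~R; set V : R := (Num.floor v)%:~R.
set U' : R := (Num.floor (u + a))%:~R; set V' : R := (Num.floor (v + b))%:~R.
set Z : R := (Num.floor w)%:~R; set Z' : R := (Num.floor _)%:~R.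
move=> u1 u2 v1 v2 ua1 ua2 vb1 vb2 w1 w2 wc1 wc2 fuR fvR.
have -> : (1%:~R + 1%:~R) * (U * V - Z + Z' + - U * V') -
    (- U + U') * (- V + V') =
  2 * (c - a * b / 2) + a * b + 2 * ((w - Z) - (w + c + u * b - Z')) +
  2 * ((u - U) * b) + 2 * (U * ((v + b - V') - (v - V))) -
  (- U + U') * (- V + V') by field.
have h1 : `|a * b| <= m%:R ^+ 2 by rewrite normrM expr2 ler_pM.
have h2 : `|(- U + U') * (- V + V')| <= m%:R ^+ 2.
  by rewrite normrM expr2 ler_pM.
have h3 : `|(u - U) * b| <= m%:R.
  rewrite normrM (ger0_norm u1) (le_trans (ler_wpM2l u1 av))//.
  by rewrite ler_piMl// ltW.
have h4 : `|U * ((v + b - V') - (v - V))| <= K * m%:R ^+ 2 + 1.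
  apply: (@le_trans _ _ `|U|).
    by rewrite normrM ler_piMr// ler_norml; apply/andP; split; lra.
  by move: uP; rewrite !ler_norml => /andP[? ?]; apply/andP; split; lra.
have m1 : 1 <= m%:R :> R by rewrite ler1n.
have m2 : m%:R <= m%:R ^+ 2 :> R by rewrite expr2 ler_peMr// ltW.
rewrite (_ : 1%:~R + 1%:~R = 2 :> R); last by ring.
move: aw h1 h2 h3 h4 KW; rewrite !ler_norml.
have -> : W%:~R = W%:R :> R by [].
move=> /andP[? ?] /andP[? ?] /andP[? ?] /andP[? ?] /andP[? ?] ?.
by apply/andP; split; lra.
Qed.

(** The path is cut into [k] pieces of length at most [m], and the cutting
    points are rounded down. *)
Lemma floor_word k (P : heis R) om K : wlen om <= k%:R * m%:R ->
  `|hu P| + k%:R * m%:R <= K * m%:R ^+ 2 -> (5 + K) * m%:R ^+ 2 <= W%:R ->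
  ((flo P)^-1 * flo (P * wend om))%g \in fset_pow S k.
Proof.
move=> + + KW; elim: k P om => [|k IH] P om.
  rewrite mul0r => om0 _.
  have om00 : wlen om = 0 by apply/eqP; rewrite eq_le om0 wlen_ge0.
  have -> : wend om = 1%g.
    apply: ccn_eq0; apply/eqP; rewrite eq_le ccn_ge0 andbT -om00.
    exact: ccn_le_word.
  by rewrite mulg1 mulVg fset_pow0 inE.
rewrite -addn1 natrD mulrDl mul1r => oml uP.
have km0 : 0 <= k%:R * m%:R :> R by rewrite mulr_ge0.
have [|om1 [om2 [omE l1 l2]]] := @word_cut _ om (Num.min m%:R (wlen om)).
  by rewrite le_min ltW//= wlen_ge0 ge_min lexx orbT.
have l1m : wlen om1 <= m%:R by rewrite l1 ge_min lexx.
have l2m : wlen om2 <= k%:R * m%:R.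
  by rewrite l2; case: (leP m%:R (wlen om)) => _; lra.
have -> : ((flo P)^-1 * flo (P * wend om) =
    ((flo P)^-1 * flo (P * wend om1)) *
    ((flo (P * wend om1))^-1 * flo ((P * wend om1) * wend om2)))%g.
  by rewrite -mulgA mulVKg -omE mulgA.
rewrite addnC; apply: fset_powD.
  apply: fset_pow1; apply: (floor_word_step (K := K)) => //.
    have : 0 <= m%:R :> R by [].
    lra.
apply: IH => //; rewrite heisE.
have := le_trans (wend_hu om1) l1m; have := ler_normD (hu P) (hu (wend om1)).
by rewrite -/m; lra.
Qed.

Lemma word_dist_psi_le M x : (6 + M) * m%:R ^+ 2 <= W%:R ->
  ccn (psi m x) <= M -> wd 1%g x <= ccn (psi m x) + m%:R^-1.
Proof.
move=> MW xM; set D := ccn _ in xM *.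
have D0 : 0 <= D by exact: ccn_ge0.
pose k := (Num.truncn (D * m%:R)).+1.
have kD : D * m%:R < k%:R by exact: truncnS_gt.
have Dk : k%:R <= D * m%:R + 1.
  rewrite /k -addn1 natrD lerD2r truncn_le mulr_ge0// ltW//.
have embE : ccn (emb x) = m%:R ^+ 2 * D.
  by rewrite /D /psi ccn_dil ?invr_gt0 ?exprn_gt0// mulVKf// gt_eqF ?exprn_gt0.
have /ccn_lt_word[om omE oml] : ccn (emb x) < k%:R * m%:R.
  by rewrite embE expr2 mulrC mulrA ltr_pM2r.
have xk : x \in fset_pow S k.
  have := @floor_word k 1%g om (M + 1); rewrite mul1g omE embK.
  have -> : flo 1%g = 1%g by rewrite -emb1 embK.
  rewrite invg1 mul1g; apply; first exact: ltW.
    rewrite hu1 normr0 add0r expr2 mulrA ler_wpM2r//.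
    apply: le_trans Dk _; rewrite mulrDl mul1r lerD ?ler_wpM2r// ler1n//.
  apply: le_trans MW; rewrite ler_wpM2r ?sqr_ge0//; lra.
rewrite /wd ler_pdivrMr// mulrDl mulVf ?gt_eqF//.
apply: le_trans Dk; apply: word_dist_le.
by rewrite invg1 mul1g.
Qed.

Let floor_ccn (Q : heis R) :
  ccn ((emb (flo Q))^-1 * Q)%g <= 2 + 4 * Num.sqrt (2 + `|hu Q|).
Proof.
apply: le_trans (ccn_le _) _; rewrite /emb /flo !heisE.
have /andP[] := floor_frac (hu Q); have /andP[] := floor_frac (hv Q).
have /andP[] := floor_frac (hw Q).
move: (hu Q) (hv Q) (hw Q) => u v w.
move: (Num.floor u)%:~R (Num.floor v)%:~R (Num.floor w)%:~R => U V Z.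
move=> w1 w2 v1 v2 u1 u2.
have uU : `|- U + u| <= 1 by rewrite ler_norml; apply/andP; split; lra.
have vV : `|- V + v| <= 1 by rewrite ler_norml; apply/andP; split; lra.
have -> : U * V - Z + w + - U * v = (w - Z) - U * (v - V) by ring.
have UV : `|(w - Z) - U * (v - V)| <= 2 + `|u|.
  have UvV : `|U * (v - V)| <= 1 + `|u|.
    apply: (@le_trans _ _ `|U|).
      by rewrite normrM [X in _ * X]ger0_norm// ler_piMr.
    have := ler_normB u (u - U); rewrite opprB addrC subrK (ger0_norm u1); lra.
  apply: le_trans (ler_normB _ _) _; rewrite ger0_norm//; lra.
by apply: lerD; [lra|rewrite ler_wpM2l// ler_wsqrtr].
Qed.

Lemma floor_approx (P : heis R) (r : R) : `|hu P| <= r ->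
  ccn ((psi m (flo (dil (m%:R ^+ 2) P)))^-1 * P)%g <=
    (2 + 4 * Num.sqrt (2 + r)) / m%:R.
Proof.
move=> uP; have r0 : 0 <= r by apply: le_trans uP; rewrite normr_ge0.
have m20 : 0 < m%:R ^+ 2 :> R by rewrite exprn_gt0.
have m1 : 1 <= m%:R :> R by rewrite ler1n.
have m21 : 1 <= m%:R ^+ 2 :> R by rewrite exprn_ege1.
set Q := dil _ P.
have -> : ((psi m (flo Q))^-1 * P = dil (m%:R ^- 2) ((emb (flo Q))^-1 * Q))%g.
  by rewrite /psi dilM dilV /Q dil_dil mulVf ?gt_eqF// dil1.
rewrite ccn_dil ?invr_gt0//.
have Qle : ccn ((emb (flo Q))^-1 * Q)%g <= 2 + 4 * (m%:R * Num.sqrt (2 + r)).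
  apply: le_trans (floor_ccn Q) _; rewrite lerD2l ler_wpM2l//.
  have -> : m%:R * Num.sqrt (2 + r) = Num.sqrt (m%:R ^+ 2 * (2 + r)).
    by rewrite sqrtrM ?sqr_ge0// sqrtr_sqr ger0_norm.
  rewrite ler_wsqrtr// /Q /dil heisE normrM (ger0_norm (ltW m20)) mulrDr.
  apply: lerD; last by rewrite ler_wpM2l// ltW.
  by rewrite mulrC ler_peMr.
rewrite mulrC ler_pdivrMr//; apply: le_trans Qle _.
have -> : (2 + 4 * Num.sqrt (2 + r)) / m%:R * m%:R ^+ 2 =
  2 * m%:R + 4 * (m%:R * Num.sqrt (2 + r)) by field; rewrite gt_eqF.
by rewrite lerD2r ler_peMr.
Qed.

End Fixed.

Lemma dil_close (P : heis R) (r t : R) : ccn P <= r -> 0 < t <= 1 ->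
  ccn ((dil t P)^-1 * P)%g <= 14 * r * Num.sqrt (1 - t).
Proof.
move=> Pr /andP[t0 t1]; have r0 : 0 <= r by apply: le_trans Pr; exact: ccn_ge0.
have uP := le_trans (ccn_hu P) Pr; have vP := le_trans (ccn_hv P) Pr.
have wP : `|hw P| <= 2 * r ^+ 2.
  apply: le_trans (ccn_hw P) _; rewrite ler_wpM2l// ler_pXn2r// nnegrE//.
  exact: ccn_ge0.
set s := Num.sqrt (1 - t).
have t1' : 0 <= 1 - t by rewrite subr_ge0.
have s0 : 0 <= s by rewrite sqrtr_ge0.
have s2 : 1 - t = s ^+ 2 by rewrite sqr_sqrtr.
have s1 : s <= 1.
  by rewrite /s -[leRHS]sqrtr1 ler_wsqrtr//; lra.
have ss : s ^+ 2 <= s by rewrite expr2 ler_piMr.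
apply: le_trans (ccn_le _) _; rewrite /dil !heisE.
have -> : - (t * hu P) + hu P = s ^+ 2 * hu P by rewrite -s2; ring.
have -> : - (t * hv P) + hv P = s ^+ 2 * hv P by rewrite -s2; ring.
have -> : t * hu P * (t * hv P) - t ^+ 2 * hw P + hw P + - (t * hu P) * hv P =
  s ^+ 2 * ((1 + t) * hw P - t * (hu P * hv P)) by rewrite -s2; ring.
rewrite !normrM (ger0_norm s0) -!expr2 sqrtrM ?sqr_ge0// sqrtr_sqr (ger0_norm s0).
have w3 : Num.sqrt `|(1 + t) * hw P - t * (hu P * hv P)| <= 3 * r.
  rewrite -[leRHS](@ger0_norm _ (3 * r)) ?mulr_ge0// -(sqrtr_sqr (3 * r)).
  rewrite ler_wsqrtr//.
  apply: le_trans (ler_normB _ _) _; rewrite !normrM (ger0_norm (ltW t0)).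
  rewrite (@ger0_norm _ (1 + t)); last lra.
  have h1 : (1 + t) * `|hw P| <= 2 * (2 * r ^+ 2).
    by apply: ler_pM => //; lra.
  have h2 : t * (`|hu P| * `|hv P|) <= r ^+ 2.
    rewrite -[leRHS]mul1r expr2; apply: ler_pM; rewrite ?mulr_ge0 ?(ltW t0)//.
    exact: ler_pM.
  rewrite exprMn; have : 0 <= r ^+ 2 by exact: sqr_ge0.
  lra.
have h1 : s ^+ 2 * `|hu P| <= s * r by apply: ler_pM; rewrite ?sqr_ge0.
have h2 : s ^+ 2 * `|hv P| <= s * r by apply: ler_pM; rewrite ?sqr_ge0.
have h3 := ler_wpM2l s0 w3.
lra.
Qed.

End Compare.

(** * Gromov-Hausdorff convergence *)

Section Convergence.
Context (R : realType).
Notation ccn := (@ccn R).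
Notation d := (cc_dist (@linf_norm R)).

Section Scale.
Variables (m W : nat) (m0 : (0 < m)%N) (W0 : (0 < W)%N) (r : R) (r0 : 0 < r).
Let wd x y : R := word_dist R (heis_gen m W) x y / m%:R.
Let q : R := W%:R / m%:R ^+ 3.
Let c : R := 4 * Num.sqrt (r * q).

(** The rescaled embedding may increase the norm of a point of the ball of
    radius [r] by [c]; the dilation brings the point back into the ball. *)
Definition gh_map (x : heis int) : heis R := dil (r / (r + c)) (psi R m x).

Let q0 : 0 <= q. Proof. by rewrite divr_ge0// exprn_ge0. Qed.
Let c0 : 0 <= c. Proof. by rewrite mulr_ge0// sqrtr_ge0. Qed.
Let rc0 : 0 < r + c. Proof. exact: ltr_wpDr. Qed.
Let l0 : 0 < r / (r + c). Proof. by rewrite divr_gt0. Qed.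
Let l1 : r / (r + c) <= 1. Proof. by rewrite ler_pdivrMr// mul1r lerDl. Qed.

Let psi1 : psi R m 1%g = 1%g.
Proof. by rewrite /psi emb1 dil_one. Qed.

Let dist_gh_map x y :
  d (gh_map x) (gh_map y) = r / (r + c) * d (psi R m x) (psi R m y).
Proof. by rewrite !cc_distE /gh_map -dilV -dilM ccn_dil. Qed.

Let wdP : is_metric wd.
Proof.
apply: word_metric; [exact: heis_gen_sym|exact: heis_gen_generating|].
by rewrite ltr0n.
Qed.

Let wd_ge0 x y : 0 <= wd x y.
Proof.
have := is_metric_tri wdP y x x; rewrite (is_metric_xx wdP).
rewrite (is_metric_sym wdP y x); lra.
Qed.

Lemma gh_map_ball x : wd 1%g x <= r -> d 1%g (gh_map x) <= r.
Proof.
move=> xr; have -> : 1%g = gh_map 1%g by rewrite /gh_map psi1 dil_one.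
rewrite dist_gh_map -mulrA ler_piMr ?(ltW r0)// mulrC ler_pdivrMr// mul1r.
apply: le_trans (ccn_psi_le R m0 W0 _ _) _; rewrite -/q -/(wd _ _).
apply: lerD => //; rewrite ler_wpM2l// ler_wsqrtr//.
by rewrite ler_wpM2r.
Qed.

Lemma wd_ball_diam x y : wd 1%g x <= r -> wd 1%g y <= r -> wd x y <= 2 * r.
Proof.
move=> xr yr; have := is_metric_tri wdP 1%g x y.
rewrite (is_metric_sym wdP x 1%g); lra.
Qed.

Variables (eps t k : R).
Hypotheses (eps0 : 0 < eps) (t0 : 0 < t) (t1 : t < 1) (teps : t <= eps)
  (tr : 14 * r * Num.sqrt (2 * t) <= eps / 2).
Hypotheses (keps : k <= eps / 2) (kt : k <= t * r) (k1 : k <= 1).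
Let sigma : R := (2 + 4 * Num.sqrt (2 + r)) / m%:R.
Hypotheses (qk : 4 * Num.sqrt (2 * r * q) <= k) (sk : sigma + m%:R^-1 <= k)
  (MW : (6 + (2 * r + 1)) * m%:R ^+ 2 <= W%:R).

Let mi0 : 0 < m%:R^-1 :> R. Proof. by rewrite invr_gt0 ltr0n. Qed.
Let sigma0 : 0 <= sigma.
Proof. by rewrite mulr_ge0 ?(ltW mi0)// addr_ge0// mulr_ge0// sqrtr_ge0. Qed.

Local Ltac slra := have := r0; have := t0; have := t1; have := teps;
  have := keps; have := kt; have := k1; have := sk; have := mi0;
  have := sigma0; have := eps0; lra.
Local Ltac snra := have := r0; have := t0; have := t1; nra.

Let lt : 1 - t <= r / (r + c).
Proof.
have ck : c <= t * r.
  apply: le_trans kt; apply: le_trans qk; rewrite ler_wpM2l// ler_wsqrtr//.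
  by apply: ler_wpM2r => //; slra.
rewrite ler_pdivlMr//.
have : (1 - t) * (r + c) <= (1 - t) * (r + t * r).
  by apply: ler_wpM2l; slra.
have : 0 <= t ^+ 2 * r by rewrite mulr_ge0 ?sqr_ge0// ltW.
snra.
Qed.

Let lower x y : d (psi R m x) (psi R m y) <= 2 * r + 1 ->
  wd x y <= d (psi R m x) (psi R m y) + m%:R^-1.
Proof.
rewrite cc_distE -psiV -psiM => xyM.
have := word_dist_psi_le m0 W0 MW xyM.
suff -> : wd x y = wd 1%g (x^-1 * y)%g by [].
by rewrite /wd /word_dist invg1 mul1g.
Qed.

Lemma gh_map_distortion x y : wd 1%g x <= r -> wd 1%g y <= r ->
  (1 - eps) * wd x y - eps <= d (gh_map x) (gh_map y) <= (1 + eps) * wd x y + eps.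
Proof.
move=> xr yr; have xy := wd_ball_diam xr yr; have xy0 := wd_ge0 x y.
have up : d (psi R m x) (psi R m y) <= wd x y + k.
  apply: le_trans (ccn_psi_le R m0 W0 _ _) _; rewrite -/q -/(wd _ _) lerD2l.
  by apply: le_trans qk; rewrite ler_wpM2l// ler_wsqrtr// ler_wpM2r.
have lo : wd x y <= d (psi R m x) (psi R m y) + m%:R^-1 by apply: lower; slra.
have D0 : 0 <= d (psi R m x) (psi R m y) by rewrite cc_distE; exact: ccn_ge0.
rewrite dist_gh_map; set D := d _ _ in up lo D0 *; set l := r / (r + c).
have lD : l * D <= D by rewrite ler_piMl.
have lD' : (1 - t) * D <= l * D by rewrite ler_wpM2r.
have epsw : 0 <= eps * wd x y by rewrite mulr_ge0// ltW.
have tw : t * wd x y <= eps * wd x y by rewrite ler_wpM2r.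
have h : (1 - t) * wd x y <= (1 - t) * (D + m%:R^-1).
  by apply: ler_wpM2l => //; slra.
have h' : (1 - t) * m%:R^-1 <= m%:R^-1 by rewrite ler_piMl ?(ltW mi0)//; slra.
by apply/andP; split; slra.
Qed.

(** The point [y] is first shrunk by the factor [1 - t], so that the rounding
    errors do not push its approximation out of the ball. *)
Lemma gh_map_dense y : d 1%g y <= r ->
  exists2 x, wd 1%g x <= r & d (gh_map x) y <= eps.
Proof.
move=> yr; pose mu := 1 - t.
have mu0 : 0 < mu by rewrite subr_gt0.
have yr' : ccn y <= r by [].
have mur : mu * r <= r by rewrite ler_piMl ?(ltW r0)// /mu; slra.
have y'r : ccn (dil mu y) <= mu * r by rewrite ccn_dil// ler_wpM2l// ltW.
pose x := flo (dil (m%:R ^+ 2) (dil mu y)).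
have xy' : ccn ((psi R m x)^-1 * dil mu y)%g <= sigma.
  apply: floor_approx => //; apply: le_trans (ccn_hu _) _.
  exact: le_trans mur.
have xn : ccn (psi R m x) <= mu * r + sigma.
  have -> : psi R m x = (dil mu y * ((psi R m x)^-1 * dil mu y)^-1)%g.
    by rewrite invgM invgK mulgA mulgV mul1g.
  by apply: le_trans (ccnM _ _) _; rewrite ccnV lerD.
exists x.
  have := @lower 1%g x; rewrite psi1 cc_distE invg1 mul1g => lo.
  have xM : ccn (psi R m x) <= 2 * r + 1 by apply: le_trans xn _; slra.
  apply: le_trans (lo xM) _; rewrite /mu in xn; slra.
set l := r / (r + c).
apply: le_trans (is_metric_tri (cc_dist_metric R) (dil l (dil mu y)) _ _) _.
have h1 : d (gh_map x) (dil l (dil mu y)) <= sigma.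
  rewrite cc_distE /gh_map -dilV -dilM ccn_dil//.
  by apply: le_trans xy'; rewrite ler_piMl// ccn_ge0.
have lmu : 1 - l * mu <= 2 * t.
  have : (1 - t) * (1 - t) <= l * mu.
    by apply: ler_pM => //; rewrite subr_ge0 ltW.
  have : 0 <= t ^+ 2 by exact: sqr_ge0.
  snra.
have h2 : d (dil l (dil mu y)) y <= eps / 2.
  apply: le_trans tr; rewrite dil_dil cc_distE.
  apply: le_trans (dil_close yr' _) _.
    by rewrite mulr_gt0//= mulr_ile1// ltW// /mu; slra.
  by apply: ler_wpM2l; [rewrite mulr_ge0// ltW|exact: ler_wsqrtr lmu].
have := mi0; slra.
Qed.

End Scale.

Variable W : nat -> nat.
Hypothesis W0 : forall m, (0 < W m)%N.
(** In [m] steps the central parts of the generators add up to [m W m], which is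
    negligible against the area [m ^ 4] that horizontal words enclose. *)
Hypothesis Wsmall : forall e : R, 0 < e ->
  exists N, forall m, (N <= m)%N -> (W m)%:R / m%:R ^+ 3 <= e.
(** The errors made by rounding, of order [m ^ 2] at each step, are absorbed. *)
Hypothesis Wlarge : forall K : R,
  exists N, forall m, (N <= m)%N -> K * m%:R ^+ 2 <= (W m)%:R.

Theorem heis_gen_gh_cvg : pointed_gh_cvg
  (fun (n : nat) (x y : heis int) =>
     word_dist R (heis_gen n.+1 (W n.+1)) x y / n.+1%:R)
  (fun=> 1%g) d 1%g.
Proof.
move=> r r0; split.
- move=> n; have [sym gen] : symmetric_fset (heis_gen n.+1 (W n.+1)) /\
      generating_fset (heis_gen n.+1 (W n.+1)).
    by split; [exact: heis_gen_sym|exact: heis_gen_generating].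
  apply: finite_compact_metric; first exact: word_metric.
  exact: word_ball_finite.
- exact: compact_cball.
- by exists (2 * r) => n x y; apply: wd_ball_diam.
- exists (fun n => gh_map n.+1 (W n.+1) r); split.
    by move=> n x; exact: gh_map_ball.
  move=> eps eps0.
  (* All error terms are at most [k]; points are shrunk by the factor [1 - t]. *)
  pose t := Num.min (1 / 2) (Num.min eps ((eps / (28 * r)) ^+ 2 / 2)).
  pose k := Num.min (eps / 2) (Num.min (t * r) 1).
  have r28 : 0 < eps / (28 * r) by rewrite divr_gt0// mulr_gt0.
  have t0 : 0 < t.
    have e2 : 0 < (eps / (28 * r)) ^+ 2 / 2 by rewrite divr_gt0// exprn_gt0.
    by rewrite /t !lt_min eps0 e2 divr_gt0.
  have tle : [/\ t <= 1 / 2, t <= eps & t <= (eps / (28 * r)) ^+ 2 / 2].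
    by rewrite /t; split; rewrite !ge_min lexx ?orbT.
  have k0 : 0 < k by rewrite /k !lt_min (mulr_gt0 t0 r0) divr_gt0//= ltr01.
  have kle : [/\ k <= eps / 2, k <= t * r & k <= 1].
    by rewrite /k; split; rewrite !ge_min lexx ?orbT.
  case: tle kle => t2 teps teps2 [keps kt k1].
  have tr : 14 * r * Num.sqrt (2 * t) <= eps / 2.
    have : Num.sqrt (2 * t) <= eps / (28 * r).
      rewrite -[leRHS](@ger0_norm _ (eps / (28 * r))) ?(ltW r28)//.
      rewrite -(sqrtr_sqr (eps / (28 * r))) ler_wsqrtr//; lra.
    move=> /(ler_wpM2l (_ : 0 <= 14 * r)); rewrite mulr_ge0 ?(ltW r0)//.
    move=> /(_ isT) h; apply: le_trans h _.
    by rewrite le_eqVlt; apply/orP; left; apply/eqP; field; rewrite gt_eqF.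
  have e1 : 0 < (k / 4) ^+ 2 / (2 * r).
    by apply: divr_gt0; [rewrite exprn_gt0// divr_gt0|exact: mulr_gt0].
  have [N1 hN1] := Wsmall e1.
  have [N2 hN2] := Wlarge (6 + (2 * r + 1)).
  pose s : R := 3 + 4 * Num.sqrt (2 + r).
  have s0 : 0 < s by rewrite ltr_wpDr// mulr_ge0// sqrtr_ge0.
  pose N := maxn (maxn N1 N2) (Num.truncn (s / k)).
  exists N => // n /= Nn.
  have n1 : (N1 <= n.+1)%N by apply: leq_trans (leqW Nn); rewrite !leq_max leqnn.
  have n2 : (N2 <= n.+1)%N.
    by apply: leq_trans (leqW Nn); rewrite !leq_max leqnn orbT.
  have nk : s / n.+1%:R <= k.
    rewrite ler_pdivrMr// mulrC -ler_pdivrMr//.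
    apply/ltW/(lt_le_trans (truncnS_gt _)); rewrite ler_nat ltnS.
    by apply: leq_trans Nn; rewrite leq_max leqnn orbT.
  have qk : 4 * Num.sqrt (2 * r * ((W n.+1)%:R / n.+1%:R ^+ 3)) <= k.
    rewrite mulrC -ler_pdivlMr// -[leRHS](@ger0_norm _ (k / 4)); last first.
      by rewrite divr_ge0// ltW.
    rewrite -(sqrtr_sqr (k / 4)) ler_wsqrtr// mulrC -ler_pdivlMr ?mulr_gt0//.
    exact: hN1.
  have sk : (2 + 4 * Num.sqrt (2 + r)) / n.+1%:R + n.+1%:R^-1 <= k.
    by apply: le_trans nk; rewrite -{2}[_^-1]mul1r -mulrDl ler_pM2r ?invr_gt0// /s;
      lra.
  have t1 : t < 1 by lra.
  split.
    by move=> y; exact: (gh_map_dense (ltn0Sn n) (W0 _) r0 eps0 t0 t1 teps tr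
      keps kt k1 qk sk (hN2 _ n2)).
  by move=> x y; exact: (gh_map_distortion (ltn0Sn n) (W0 _) r0 eps0 t0 t1 teps
    keps kt k1 qk sk (hN2 _ n2)).
Qed.

End Convergence.

(** * Growth of the generating sets *)

Section Growth.
Context (R : realType).

(** The ratio of the cardinalities is of order [n ^ 2 (n ^ 4 + n W) / W]: its
    first term is governed by [n ^ 3 / W] and its second one is [n ^ 3]. *)
Lemma heis_gen_growth (n W : nat) (F f1 : R) : (0 < n)%N -> (0 < W)%N ->
  0 < f1 -> f1 <= F -> n%:R ^+ 3 <= W%:R * F ->
  (#|` fset_pow (heis_gen n W) n|)%:R <=
    (45 + 18 / f1) * F * n%:R ^+ 3 * (#|` heis_gen n W|)%:R.
Proof.
move=> n0 W0 f10 f1F nWF.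
have F0 : 0 < F by apply: lt_le_trans f1F.
apply: (@le_trans _ _ ((45 + 18 / f1) * F * n%:R ^+ 3 * (n * n * W)%:R));
  last first.
  rewrite ler_wpM2l ?ler_nat ?card_heis_gen// !mulr_ge0 ?(ltW F0)//.
  by rewrite addr_ge0// divr_ge0// ltW.
have le_box := leq_trans (fsubset_leq_card (heis_gen_pow_box n W n))
  (card_heis_box _ _ _).
apply: (@le_trans _ _ (_%:R)); first by rewrite ler_nat; exact: le_box.
rewrite !(natrM, natrD).
have : 1 <= n%:R :> R by rewrite ler1n.
have : 1 <= W%:R :> R by rewrite ler1n.
move: nWF; move: (n%:R) (W%:R) => x w nWF w1 x1.
have x0 : 0 <= x by lra.
have w0 : 0 <= w by lra.
have x2 : 1 <= x ^+ 2 by rewrite exprn_ege1.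
have x3 : x ^+ 3 <= x ^+ 4 by rewrite ler_weXn2l.
have x4 : 1 <= x ^+ 4 by rewrite exprn_ege1.
have A0 : 0 <= 2 * x ^+ 2 + 1 by lra.
have A : 2 * x ^+ 2 + 1 <= 3 * x ^+ 2 by lra.
have AA : (2 * x ^+ 2 + 1) * (2 * x ^+ 2 + 1) <= 9 * x ^+ 4.
  have -> : 9 * x ^+ 4 = (3 * x ^+ 2) * (3 * x ^+ 2) by ring.
  exact: ler_pM.
have B : 2 * (x * (x ^+ 2 + w) + x ^+ 4) + 1 <= 5 * x ^+ 4 + 2 * (x * w).
  have : x * (x ^+ 2 + w) = x ^+ 3 + x * w by ring.
  lra.
have B0 : 0 <= 2 * (x * (x ^+ 2 + w) + x ^+ 4) + 1.
  rewrite addr_ge0// mulr_ge0// addr_ge0 ?exprn_ge0// mulr_ge0//.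
  by rewrite addr_ge0// exprn_ge0.
have AB := ler_pM (mulr_ge0 A0 A0) B0 AA B.
have C1 : x ^+ 5 * x ^+ 3 <= x ^+ 5 * (w * F) by rewrite ler_wpM2l// exprn_ge0.
have C2 : 18 * (x ^+ 5 * w) <= 18 / f1 * F * (x ^+ 5 * w).
  rewrite ler_wpM2r ?mulr_ge0 ?exprn_ge0//.
  by rewrite mulrAC ler_pdivlMr// ler_wpM2l.
have -> : (x * x + x * x + 1) * (x * x + x * x + 1) *
  (x * (x * x + w) + x * x * (x * x) + (x * (x * x + w) + x * x * (x * x)) + 1)
  = (2 * x ^+ 2 + 1) * (2 * x ^+ 2 + 1) *
    (2 * (x * (x ^+ 2 + w) + x ^+ 4) + 1) by ring.
apply: le_trans AB _.
have -> : 9 * x ^+ 4 * (5 * x ^+ 4 + 2 * (x * w)) =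
  45 * (x ^+ 5 * x ^+ 3) + 18 * (x ^+ 5 * w) by ring.
have -> : (45 + 18 / f1) * F * x ^+ 3 * (x * x * w) =
  45 * (x ^+ 5 * (w * F)) + 18 / f1 * F * (x ^+ 5 * w) by ring.
lra.
Qed.

Section Width.
Variable f : R -> R.
Hypotheses (f0 : forall t, 1 <= t -> 0 < f t)
  (finf : f x @[x --> +oo] --> +oo).

(** Capping [f] by a square root keeps the width well above [n ^ 2]. *)
Let g (n : nat) : R := Num.min (f n%:R) (Num.sqrt n%:R).

Definition width (n : nat) : nat := (Num.truncn (n%:R ^+ 3 / g n)).+1.

Let width_ge n : n%:R ^+ 3 / g n <= (width n)%:R.
Proof. exact/ltW/truncnS_gt. Qed.

Let g_gt0 n : (0 < n)%N -> 0 < g n.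
Proof. by move=> n0; rewrite lt_min f0 ?ler1n//= sqrtr_gt0 ltr0n. Qed.

Let g_inf (A : R) : exists N, forall n, (N <= n)%N -> A <= g n.
Proof.
have [M [Mreal fM]] := (cvgryPge _).1 finf A.
exists (Num.truncn (Num.max M (A ^+ 2))).+1 => n Nn.
have nM : Num.max M (A ^+ 2) < n%:R.
  by apply: lt_le_trans (truncnS_gt _) _; rewrite ler_nat.
move: nM; rewrite gt_max => /andP[nM nA].
rewrite le_min fM//= (le_trans (ler_norm A))// -sqrtr_sqr ler_wsqrtr//.
exact: ltW.
Qed.

Lemma width_growth n : (0 < n)%N -> n%:R ^+ 3 <= (width n)%:R * f n%:R.
Proof.
move=> n0; apply: (@le_trans _ _ ((width n)%:R * g n)).
  by rewrite -ler_pdivrMr ?g_gt0.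
by rewrite ler_wpM2l// ge_min lexx.
Qed.

Lemma width_small (e : R) : 0 < e ->
  exists N, forall m, (N <= m)%N -> (width m)%:R / m%:R ^+ 3 <= e.
Proof.
move=> e0; have [N hN] := g_inf (2 / e).
exists (maxn N (Num.truncn (2 / e)).+1) => m; rewrite geq_max => /andP[Nm em].
have m0 : (0 < m)%N by apply: leq_ltn_trans em.
have mR : 1 <= m%:R :> R by rewrite ler1n.
have m3 : 0 < m%:R ^+ 3 :> R by rewrite exprn_gt0// ltr0n.
have g0 := g_gt0 m0.
rewrite ler_pdivrMr// /width -addn1 natrD.
have h1 : (Num.truncn (m%:R ^+ 3 / g m))%:R <= m%:R ^+ 3 / g m :> R.
  by rewrite truncn_le divr_ge0// ltW.
have h2 : m%:R ^+ 3 / g m <= e / 2 * m%:R ^+ 3.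
  rewrite ler_pdivrMr// mulrAC ler_peMl ?(ltW m3)//.
  have : 2 <= g m * e by rewrite -ler_pdivrMr// hN.
  lra.
have h3 : 1 <= e / 2 * m%:R ^+ 3.
  have me : 2 <= m%:R * e.
    rewrite -ler_pdivrMr//; apply/ltW/(lt_le_trans (truncnS_gt _)).
    by rewrite ler_nat.
  have : e / 2 * m%:R <= e / 2 * m%:R ^+ 3.
    by rewrite ler_wpM2l ?divr_ge0 ?(ltW e0)// ler_eXnr.
  lra.
lra.
Qed.

Lemma width_large (K : R) :
  exists N, forall m, (N <= m)%N -> K * m%:R ^+ 2 <= (width m)%:R.
Proof.
exists (Num.truncn (K ^+ 2)).+1 => m Km.
have m0 : (0 < m)%N by apply: leq_ltn_trans Km.
have mR : 0 < m%:R :> R by rewrite ltr0n.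
have sm0 : 0 < Num.sqrt m%:R :> R by rewrite sqrtr_gt0.
apply: le_trans (width_ge m).
have Ks : K <= Num.sqrt m%:R.
  rewrite (le_trans (ler_norm K))// -sqrtr_sqr ler_wsqrtr//.
  by apply/ltW/(lt_le_trans (truncnS_gt _)); rewrite ler_nat.
rewrite ler_pdivlMr ?g_gt0//.
apply: (@le_trans _ _ (Num.sqrt m%:R * m%:R ^+ 2 * Num.sqrt m%:R)).
  apply: (@le_trans _ _ (Num.sqrt m%:R * m%:R ^+ 2 * g m)).
    by rewrite ler_wpM2r ?(ltW (g_gt0 m0))// ler_wpM2r ?exprn_ge0.
  rewrite ler_wpM2l ?mulr_ge0 ?(ltW sm0) ?exprn_ge0//.
  by rewrite ge_min lexx orbT.
by rewrite mulrAC -expr2 sqr_sqrtr// -exprS.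
Qed.

End Width.

Theorem slow_growth_gh_cvg (f : R -> R) :
  (forall t, 1 <= t -> 0 < f t) ->
  (forall s t, 1 <= s -> s <= t -> f s <= f t) ->
  f x @[x --> +oo] --> +oo ->
  exists S : nat -> {fset heis int},
    [/\ forall n, symmetric_fset (S n) /\ generating_fset (S n),
        exists C : R, forall n : nat, (0 < n)%N ->
          (#|` fset_pow (S n) n|)%:R
            <= C * f n%:R * n%:R ^+ 3 * (#|` S n|)%:R &
        pointed_gh_cvg
          (fun (n : nat) (x y : heis int) =>
             word_dist R (S n.+1) x y / n.+1%:R)
          (fun=> 1%g)
          (cc_dist (@linf_norm R)) 1%g].
Proof.
move=> f0 fmono finf.
(* The shift only matters for the index 0, where the bound on the first two
   coordinates has to be positive for the set to generate. *)
exists (fun n => heis_gen n.-1.+1 (width f n)); split.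
- by move=> n; split; [exact: heis_gen_sym|exact: heis_gen_generating].
- exists (45 + 18 / f 1) => -[//|n] _.
  apply: heis_gen_growth => //; [exact: f0|by apply: fmono; rewrite ?ler1n|].
  exact: width_growth.
- apply: heis_gen_gh_cvg => //; [exact: width_small|exact: width_large].
Qed.

End Growth.

(** * Hausdorff measures *)

Lemma finite_eseries (R : realType) (u : nat -> \bar R) (m K : nat) :
  (m <= K)%N -> (forall i, (K <= i)%N -> u i = 0%E) ->
  (\sum_(m <= i <oo) u i = \sum_(m <= i < K) u i)%E.
Proof.
move=> mK u0; apply: (@lim_near_cst) => //; exists K => // n /= Kn.
have tail : (\sum_(K <= i < n) u i = 0)%E.
  by rewrite big_nat big1// => i /andP[Ki _]; exact: u0.
by rewrite (@big_cat_nat _ _ _ K)//= tail adde0.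
Qed.

Section HausdorffGeneral.
Context (R : realType) (T : Type) (d : T -> T -> R).
Local Open Scope ereal_scope.
Implicit Types (U A : set T) (s delta : R).

Lemma diam_pow_ge0 s U : 0 <= diam_pow d s U.
Proof. by rewrite /diam_pow; case: (pselect _) => //= _; exact: poweR_ge0. Qed.

Lemma diam_pow_set0 s : diam_pow d s set0 = 0.
Proof. by rewrite /diam_pow; case: (pselect _) => //= h; case: h. Qed.

Lemma diam_pow_le s (r : R) U : (0 <= s)%R -> (0 <= r)%R ->
  (forall x, 0 <= d x x)%R ->
  diam d U <= r%:E -> diam_pow d s U <= (r `^ s)%:E.
Proof.
move=> s0 r0 d0 Ur; rewrite /diam_pow; case: (pselect _) => /= [_|/eqP/set0P[x Ux]].
  by rewrite lee_fin powR_ge0.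
rewrite -poweR_EFin; apply: gt0_ler_poweR => //.
  rewrite in_itv /= leey andbT; apply: (@le_trans _ _ (d x x)%:E).
    by rewrite lee_fin.
  by apply: ereal_sup_ubound; exists (x, x).
by rewrite in_itv /= leey andbT lee_fin.
Qed.

Lemma diamP U (r : R) : (forall x y, U x -> U y -> (d x y <= r)%R) ->
  diam d U <= r%:E.
Proof.
move=> h; apply: ub_ereal_sup => _ [[x y] [Ux Uy] <-].
by rewrite lee_fin; exact: h.
Qed.

Lemma diam_ub U x y : U x -> U y -> (d x y)%:E <= diam d U.
Proof. by move=> Ux Uy; apply: ereal_sup_ubound; exists (x, y). Qed.

Lemma hausdorff_content_ge0 s delta A : 0 <= hausdorff_content d s delta A.
Proof.
apply/ereal_infP => _ [U _ <-]; apply: nneseries_ge0 => k _ _.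
exact: diam_pow_ge0.
Qed.

Lemma hausdorff_measure_eq0 s A :
  (forall delta, (0 < delta)%R -> hausdorff_content d s delta A = 0) ->
  hausdorff_measure d s A = 0.
Proof.
move=> h; apply/eqP; rewrite eq_le; apply/andP; split.
  by apply: ub_ereal_sup => _ [delta d0 <-]; rewrite h.
by apply: ereal_sup_ubound; exists 1%R; [exact: ltr01|rewrite h].
Qed.

(** The terms being nonnegative, the double sum can be reindexed along a
    bijection between [nat] and [nat * nat]. *)
Lemma hausdorff_content_le_double s delta A (V : nat -> nat -> set T) :
  (forall i j, diam d (V i j) <= delta%:E) ->
  A `<=` \bigcup_i \bigcup_j V i j ->
  hausdorff_content d s delta A <=
    \sum_(i <oo) \sum_(j <oo) diam_pow d s (V i j).
Proof.
move=> Vd AV.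
have /card_set_bijP[e eP] : ([set: nat] #= [set: nat * nat])%card.
  by rewrite card_eq_sym; exact: card_nat2.
have [_ _ esurj] := eP.
apply: (@le_trans _ _ (\sum_(k <oo) diam_pow d s (V (e k).1 (e k).2))).
  apply: ereal_inf_lbound; exists (fun k => V (e k).1 (e k).2) => //.
  split=> // x /AV[i _ [j _ Vx]].
  by have [k _ ek] := esurj (i, j) I; exists k => //; rewrite ek.
rewrite nneseries_esumT; last by move=> k; exact: diam_pow_ge0.
rewrite -(reindex_esum _ _ _ (fun p => diam_pow d s (V p.1 p.2)) eP).
rewrite nneseries_esumT; last first.
  by move=> i; apply: nneseries_ge0 => j _ _; exact: diam_pow_ge0.
under [X in _ <= X]eq_esum.
  move=> i _; rewrite nneseries_esumT; last by move=> j; exact: diam_pow_ge0.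
  over.
rewrite esum_esum; last by move=> *; exact: diam_pow_ge0.
rewrite le_eqVlt; apply/orP; left; apply/eqP; congr esum.
by apply/seteqP; split.
Qed.

End HausdorffGeneral.

(** * The Hausdorff dimension is at most 4 *)

Section UpperBound.
Context (R : realType).
Notation ccn := (@ccn R).
Notation d := (cc_dist (@linf_norm R)).

Definition cell (N : nat) (x : heis int) : set (heis R) :=
  [set P | ccn ((dil N%:R^-1 (emb R x))^-1 * P)%g <= 6 / N%:R].

Lemma diam_cell N x : (diam d (cell N x) <= (12 / N%:R)%:E)%E.
Proof.
apply: diamP => P Q; rewrite /cell /=; set c := dil _ _ => Pc Qc.
rewrite cc_distE.
have -> : (P^-1 * Q = (c^-1 * P)^-1 * (c^-1 * Q))%g.
  by rewrite invgM invgK -mulgA mulVKg.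
apply: le_trans (ccnM _ _) _; rewrite ccnV.
have -> : 12 / N%:R = 6 / N%:R + 6 / N%:R :> R by rewrite -mulrDl; congr (_ / _); ring.
exact: lerD.
Qed.

(** Rounding the third coordinate after a translation, and not before, leaves
    a remainder in the unit cube. *)
Definition lattice_floor (Q : heis R) : heis int :=
  let U := Num.floor (hu Q) in let V := Num.floor (hv Q) in
  mk U V (Num.floor (hw Q - U%:~R * (hv Q - V%:~R))).

Lemma ccn_lattice_floor Q : ccn ((emb R (lattice_floor Q))^-1 * Q)%g <= 6.
Proof.
apply: le_trans (ccn_le _) _; rewrite /lattice_floor /emb !heisE.
move: (hu Q) (hv Q) (hw Q) => u v w.
have -> : - (Num.floor u)%:~R + u = u - (Num.floor u)%:~R by ring.
have -> : - (Num.floor v)%:~R + v = v - (Num.floor v)%:~R by ring.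
set z := w - _ * _.
have -> : (Num.floor u)%:~R * (Num.floor v)%:~R - (Num.floor z)%:~R + w +
    - (Num.floor u)%:~R * v = z - (Num.floor z)%:~R by rewrite {2}/z; ring.
have /andP[u0 u1] := floor_frac u; have /andP[v0 v1] := floor_frac v.
have /andP[z0 z1] := floor_frac z; rewrite !ger0_norm//.
have : Num.sqrt (z - (Num.floor z)%:~R) <= 1.
  by rewrite -[leRHS]sqrtr1 ler_wsqrtr.
lra.
Qed.

Let floor_norm (x : R) (K : nat) : `|x| <= K%:R -> `|Num.floor x| <= K%:Z.
Proof.
rewrite ler_norml => /andP[x1 x2]; have /andP[h1 h2] := floor_itv x.
rewrite intrD in h2.
have : Num.floor x < K%:Z + 1 by rewrite -(ltr_int R) intrD; lra.
have : - K%:Z - 1 < Num.floor x by rewrite -(ltr_int R) !intrD !intrN; lra.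
lia.
Qed.

Lemma lattice_floor_box (M : nat) Q (K : nat) : (0 < M)%N ->
  `|hu Q| <= M%:R -> `|hv Q| <= M%:R -> `|hw Q| <= K%:R ->
  lattice_floor Q \in heis_box M M (K + M).
Proof.
move=> M0 uM vM wK; rewrite in_heis_box /lattice_floor !heisE.
rewrite !floor_norm//= natrD.
apply: le_trans (ler_normB _ _) _; apply: lerD => //.
have /andP[v0 v1] := floor_frac (hv Q); rewrite normrM (ger0_norm v0).
apply: (@le_trans _ _ `|(Num.floor (hu Q))%:~R|); first by rewrite ler_piMr.
by rewrite -intr_norm pmulrn ler_int floor_norm.
Qed.

Lemma cell_cover N M (P : heis R) : (0 < N)%N -> (0 < M)%N ->
  `|hu P| <= M%:R -> `|hv P| <= M%:R -> `|hw P| <= M%:R ->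
  exists2 x, x \in heis_box (M * N) (M * N) (M * N ^ 2 + M * N) & cell N x P.
Proof.
move=> N0 M0 uP vP wP.
have NR : 0 < N%:R :> R by rewrite ltr0n.
pose Q := dil N%:R P.
exists (lattice_floor Q).
  apply: lattice_floor_box; rewrite ?muln_gt0 ?M0//; rewrite /Q /dil heisE.
  - by rewrite normrM ger0_norm// natrM mulrC ler_wpM2r.
  - by rewrite normrM ger0_norm// natrM mulrC ler_wpM2r.
  - by rewrite normrM ger0_norm ?exprn_ge0// natrM natrX mulrC ler_wpM2r// exprn_ge0.
rewrite /cell /=.
have -> : ((dil N%:R^-1 (emb R (lattice_floor Q)))^-1 * P =
    dil N%:R^-1 ((emb R (lattice_floor Q))^-1 * Q))%g.
  by rewrite dilM dilV /Q dil_dil mulVf ?gt_eqF// dil1.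
rewrite ccn_dil ?invr_gt0// mulrC ler_pM2r ?invr_gt0//.
exact: ccn_lattice_floor.
Qed.

Let dxx (x : heis R) : 0 <= d x x.
Proof. by rewrite (is_metric_xx (cc_dist_metric R)). Qed.

(** For a fixed box, the number of cells of diameter of the order of [1 / N] is
    of the order of [N ^ 4]: the exponent 4 counts the two horizontal
    coordinates once and the vertical one twice. Their weight is thus of the
    order of [N ^ (4 - s)]. *)
Lemma box_content (s : R) (M : nat) (eta delta : R) :
  4 < s -> (0 < M)%N -> 0 < eta -> 0 < delta ->
  exists V : nat -> set (heis R), [/\ forall j, (diam d (V j) <= delta%:E)%E,
    [set P | [/\ `|hu P| <= M%:R, `|hv P| <= M%:R & `|hw P| <= M%:R]]
      `<=` \bigcup_j V j &
    (\sum_(j <oo) diam_pow d s (V j) <= eta%:E)%E].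
Proof.
move=> s4 M0 eta0 delta0.
have MR : 1 <= M%:R :> R by rewrite ler1n.
pose C : R := 45 * M%:R ^+ 3 * 12 ^+ 4.
have C0 : 0 < C.
  apply: mulr_gt0; last exact: exprn_gt0.
  by apply: mulr_gt0 => //; rewrite exprn_gt0// ltr0n.
(* [12 / N] bounds the diameters; once it is below [y], the total weight
   [C * (12 / N) ^ (s - 4)] is below [eta]. *)
pose y : R := (eta / C) `^ (s - 4)^-1.
have y0 : 0 < y by rewrite powR_gt0// divr_gt0.
have yE : y `^ (s - 4) = eta / C.
  by rewrite /y -powRrM mulVf ?powRr1 ?subr_eq0 ?gt_eqF// divr_ge0// ltW.
pose b := Num.min delta y.
have b0 : 0 < b by rewrite lt_min delta0.
pose N := (Num.truncn (12 / b)).+1.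
have N0 : (0 < N)%N by [].
have NR : 0 < N%:R :> R by rewrite ltr0n.
have N1 : 1 <= N%:R :> R by rewrite ler1n.
have Nb : 12 / N%:R <= b.
  rewrite ler_pdivrMr// mulrC -ler_pdivrMr//; exact/ltW/truncnS_gt.
pose B := heis_box (M * N) (M * N) (M * N ^ 2 + M * N).
pose V j := if (j < #|` B|)%N then cell N (nth 1%g (enum_fset B) j) else set0.
have Vd j : (diam d (V j) <= (12 / N%:R)%:E)%E.
  rewrite /V; case: ifP => _; first exact: diam_cell.
  by apply: diamP => x z [].
exists V; split.
- move=> j; apply: le_trans (Vd j) _; rewrite lee_fin; apply: le_trans Nb _.
  by rewrite ge_min lexx.
- move=> P [uP vP wP]; have [x xB xP] := cell_cover N0 M0 uP vP wP.
  exists (index x (enum_fset B)) => //.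
  rewrite /V; have -> : (index x (enum_fset B) < #|` B|)%N by rewrite index_mem.
  by rewrite nth_index.
- rewrite (@finite_eseries _ _ 0 #|` B|)//; last first.
    by move=> j Bj; rewrite /V ltnNge Bj /= diam_pow_set0.
  apply: (@le_trans _ _ (\sum_(0 <= j < #|` B|) ((12 / N%:R) `^ s)%:E)%E).
    apply: lee_sum => j _; apply: diam_pow_le; [| |exact: dxx|exact: Vd].
      by rewrite ltW// (lt_trans _ s4).
    by rewrite divr_ge0.
  rewrite sumEFin lee_fin big_const_nat subn0 iter_addr_0.
  have Bcard : (#|` B|)%:R <= 45 * M%:R ^+ 3 * N%:R ^+ 4 :> R.
    have := card_heis_box (M * N) (M * N) (M * N ^ 2 + M * N).
    rewrite -/B -(ler_nat R) => h; apply: le_trans h _.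
    rewrite !(natrM, natrD, natrX).
    move: (M%:R) (N%:R) MR N1 => {}m n m1 n1.
    have m0 : 0 <= m by lra.
    have n0 : 0 <= n by lra.
    have mn : 1 <= m * n by rewrite mulr_ege1.
    have mnn : m * n <= m * n ^+ 2.
      by rewrite ler_wpM2l// expr2 ler_peMr.
    have h1 : m * n + m * n + 1 <= 3 * (m * n) by lra.
    have h2 : m * n ^+ 2 + m * n + (m * n ^+ 2 + m * n) + 1 <= 5 * (m * n ^+ 2).
      by lra.
    have p1 : 0 <= m * n + m * n + 1 by lra.
    have p2 : 0 <= m * n ^+ 2 + m * n + (m * n ^+ 2 + m * n) + 1 by lra.
    apply: le_trans (ler_pM (mulr_ge0 p1 p1) p2 (ler_pM p1 p1 h1 h1) h2) _.
    rewrite le_eqVlt; apply/orP; left; apply/eqP; ring.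
  have sE : (12 / N%:R) `^ s = (12 / N%:R) ^+ 4 * (12 / N%:R) `^ (s - 4).
    rewrite -powR_mulrn ?divr_ge0// -powRD; last first.
      by apply/implyP => _; rewrite gt_eqF// divr_gt0.
    by congr (_ `^ _); ring.
  have sy : (12 / N%:R) `^ (s - 4) <= eta / C.
    rewrite -yE ge0_ler_powR ?nnegrE ?subr_ge0 ?(ltW s4) ?(ltW y0) ?divr_ge0//.
    by apply: le_trans Nb _; rewrite ge_min lexx orbT.
  rewrite -[leLHS]mulr_natr sE.
  apply: (@le_trans _ _ ((12 / N%:R) ^+ 4 * (eta / C) *
      (45 * M%:R ^+ 3 * N%:R ^+ 4))).
    have q0 : 0 <= (12 / N%:R) ^+ 4 :> R by rewrite exprn_ge0// divr_ge0.
    apply: ler_pM; [exact: mulr_ge0 q0 (powR_ge0 _ _)|exact: ler0n| |exact: Bcard].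
    exact: ler_wpM2l.
  rewrite le_eqVlt; apply/orP; left; apply/eqP; rewrite /C; field.
  by rewrite !gt_eqF// ltr0n.
Qed.

Lemma hausdorff_measure_gt4 (s : R) : 4 < s -> hausdorff_measure d s setT = 0%E.
Proof.
move=> s4; apply: hausdorff_measure_eq0 => delta delta0.
apply/eqP; rewrite eq_le hausdorff_content_ge0 andbT.
apply/lee_addgt0Pr => e e0; rewrite add0e.
have pow2 i : 0 < (2 ^ i.+1)%:R :> R by rewrite ltr0n expn_gt0.
have [V hV] := choice (fun i =>
  box_content s4 (ltn0Sn i) (divr_gt0 e0 (pow2 i)) delta0).
apply: le_trans (hausdorff_content_le_double (V := V) s _ _) _.
- by move=> i j; have [] := hV i.
- move=> P _; pose i := Num.truncn (`|hu P| + `|hv P| + `|hw P|).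
  have Pi : `|hu P| + `|hv P| + `|hw P| <= i.+1%:R by exact/ltW/truncnS_gt.
  have := normr_ge0 (hu P); have := normr_ge0 (hv P); have := normr_ge0 (hw P).
  move=> w0 v0 u0; have [_ cover _] := hV i; exists i => //; apply: cover.
  by split; lra.
- apply: le_trans (epsilon_trick0 xpredT (ltW e0)).
  apply: lee_nneseries => i _ *; last by have [] := hV i.
  by apply: nneseries_ge0 => j _ _; exact: diam_pow_ge0.
Qed.

Lemma hausdorff_dim_le4 : (hausdorff_dim d <= 4%:E)%E.
Proof.
apply/lee_addgt0Pr => e e0; apply: ereal_inf_lbound.
exists (4 + e) => //; split; first by rewrite addr_ge0// ltW.
by apply: hausdorff_measure_gt4; rewrite ltrDl.
Qed.

End UpperBound.

(** * The Hausdorff dimension is at least 4 *)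

Section LowerBound.
Context (R : realType).
Notation ccn := (@ccn R).
Notation d := (cc_dist (@linf_norm R)).
Notation leb := (@lebesgue_measure R).
(** The left translate by [P] of the box [|u| <= r], [|v| <= r],
    [|w| <= 2 r ^ 2]. Its third coordinate is constrained after undoing the
    shear that left translation performs. *)
Definition cc_base (P : heis R) (r : R) : set (R * R) :=
  `[hu P - r, hu P + r] `*` `[hv P - r, hv P + r].

Definition cc_fiber (P : heis R) (r : R) : set R :=
  `[hw P - hu P * hv P - 2 * r ^+ 2, hw P - hu P * hv P + 2 * r ^+ 2].

Definition cc_box (P : heis R) (r : R) : set (R * R * R) :=
  [set p | cc_base P r p.1 /\ cc_fiber P r (p.2 - hu P * p.1.2)].

Lemma cc_boxP (P Q : heis R) (r : R) : d P Q <= r ->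
  cc_box P r (hu Q, hv Q, hw Q).
Proof.
rewrite cc_distE => PQ; have r0 := le_trans (ccn_ge0 _) PQ.
have := le_trans (ccn_hu _) PQ; have := le_trans (ccn_hv _) PQ.
have : `|hw (P^-1 * Q)%g| <= 2 * r ^+ 2.
  apply: le_trans (ccn_hw _) _; rewrite ler_wpM2l// ler_pXn2r// nnegrE//.
  exact: ccn_ge0.
rewrite !heisE !ler_norml => /andP[w1 w2] /andP[v1 v2] /andP[u1 u2].
by split; [split|]; rewrite /cc_fiber /= in_itv /=; apply/andP; split; lra.
Qed.

Definition vol : set (R * R * R) -> \bar R := ((leb \x leb) \x leb)%E.

Lemma measurable_cc_box P r : measurable (cc_box P r).
Proof.
have -> : cc_box P r = (cc_base P r `*` setT) `&`
    ((fun p : R * R * R => p.2 - hu P * p.1.2) @^-1` cc_fiber P r).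
  apply/seteqP; split=> [p [pb pf]|p [[pb _] pf]]; last by split.
  by split=> //; split.
apply: measurableI.
  by apply: measurableX => //; apply: measurableX; exact: measurable_itv.
rewrite -[X in measurable X]setTI.
have mf : measurable_fun setT (fun p : R * R * R => p.2 - hu P * p.1.2).
  apply: measurable_funB; first exact: measurable_snd.
  apply: measurable_funM; first exact: measurable_cst.
  apply: measurableT_comp; [exact: measurable_snd|exact: measurable_fst].
apply: mf => //; exact: measurable_itv.
Qed.

Let leb_itv (a b : R) : a <= b -> leb `[a, b] = (b - a)%:E.
Proof.
move=> ab; have := @lebesgue_measure_itv R `[a, b]; rewrite /= => ->.
case: ltP => //; rewrite lee_fin => ba.
have -> : b = a by apply/eqP; rewrite eq_le ab; rewrite ba.
by rewrite subrr.
Qed.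

Let leb_rect (a b a' b' : R) : a <= b -> a' <= b' ->
  (leb \x leb)%E (`[a, b] `*` `[a', b']) = ((b - a) * (b' - a'))%:E.
Proof.
move=> ab ab'; transitivity (leb `[a, b] * leb `[a', b'])%E.
  by apply: product_measure1E; exact: measurable_itv.
by rewrite !leb_itv// EFinM.
Qed.

(** The section of the box over a point of its base is an interval whose
    position depends on the point, but not its length. *)
Lemma vol_cc_box P r : 0 <= r -> vol (cc_box P r) = (16 * r ^+ 4)%:E.
Proof.
move=> r0; rewrite -[LHS]/(\int[(leb \x leb)%E]_p
  (leb \o xsection (cc_box P r)) p)%E.
have sec p : leb (xsection (cc_box P r) p) =
    ((cst (4 * r ^+ 2)%:E) \_ (cc_base P r)) p.
  rewrite patchE; case: ifPn => [/set_mem pb|pb].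
    pose c := hw P - hu P * hv P + hu P * p.2.
    have -> : xsection (cc_box P r) p =
        `[c - 2 * r ^+ 2, c + 2 * r ^+ 2]%classic.
      apply/seteqP; split=> w /=.
        move=> /xsectionP[_]; rewrite /cc_fiber /= !in_itv /= /c.
        by move=> /andP[? ?]; apply/andP; split; lra.
      rewrite in_itv /= /c => /andP[? ?]; apply/xsectionP; split => //.
      by rewrite /cc_fiber /= in_itv /=; apply/andP; split; lra.
    have r20 : 0 <= r ^+ 2 by rewrite sqr_ge0.
    by rewrite leb_itv; [congr EFin; ring|lra].
  suff -> : xsection (cc_box P r) p = set0 by rewrite measure0.
  apply/seteqP; split=> w //= /xsectionP[pb' _].
  by move: pb; rewrite notin_setE.
transitivity (\int[(leb \x leb)%E]_(p in cc_base P r) cst (4 * r ^+ 2)%:E p)%E.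
  by rewrite [RHS]integral_mkcond; apply: eq_integral => p _; exact: sec.
transitivity ((4 * r ^+ 2)%:E * (leb \x leb)%E (cc_base P r))%E.
  by apply: integral_cst; apply: measurableX; exact: measurable_itv.
rewrite /cc_base leb_rect; [|lra|lra].
by rewrite -!EFinM; congr EFin; ring.
Qed.

Lemma vol_unit_cube : vol ((`[0, 1] `*` `[0, 1]) `*` `[0, 1]) = 1%E.
Proof.
transitivity ((leb \x leb)%E (`[0%R, 1%R] `*` `[0%R, 1%R]) * leb `[0%R, 1%R])%E.
  apply: product_measure1E; last exact: measurable_itv.
  by apply: measurableX; exact: measurable_itv.
by rewrite leb_rect// leb_itv// subr0 mulr1 mule1.
Qed.

(** The box of size [r] has sides of order [r], [r] and [r ^ 2], and the fourth
    power is dominated by the power [s] for diameters at most 1. *)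
Lemma diam_box (s : R) (U : set (heis R)) : 0 <= s -> s < 4 ->
  (diam d U <= 1%:E)%E -> exists B, [/\ measurable B,
    forall Q, U Q -> B (hu Q, hv Q, hw Q) &
    (vol B <= 16%:E * diam_pow d s U)%E].
Proof.
move=> s0 s4 U1.
case: (pselect (U = set0)) => [->|/eqP/set0P[P UP]].
  exists set0; split=> //.
  by rewrite diam_pow_set0 mule0 /vol measure0.
have dge0 : (0 <= diam d U)%E.
  apply: le_trans (diam_ub d UP UP).
  by rewrite lee_fin (is_metric_xx (cc_dist_metric R)).
have dfin : (diam d U \is a fin_num)%E.
  by rewrite ge0_fin_numE// (le_lt_trans U1)// ltey.
pose r := fine (diam d U).
have dE : diam d U = r%:E by rewrite fineK.
have r0 : 0 <= r by rewrite fine_ge0.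
have r1 : r <= 1 by rewrite -lee_fin -dE.
exists (cc_box P r); split.
- exact: measurable_cc_box.
- by move=> Q UQ; apply: cc_boxP; rewrite -lee_fin -dE; exact: diam_ub.
- rewrite vol_cc_box// /diam_pow; case: (pselect _) => /= [U0|_].
    by rewrite U0 in UP.
  rewrite dE poweR_EFin -EFinM lee_fin ler_wpM2l//.
  have [->|rn0] := eqVneq r 0; first by rewrite expr0n powR_ge0.
  have -> : r ^+ 4 = r `^ s * r `^ (4 - s).
    rewrite -powRD ?rn0 ?implybT// -powR_mulrn//; congr (_ `^ _); ring.
  rewrite ler_piMr ?powR_ge0//.
  apply: (@le_trans _ _ (1 `^ (4 - s))); last by rewrite powR1.
  by rewrite ge0_ler_powR ?nnegrE ?subr_ge0 ?(ltW s4).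
Qed.

(** A cover of small weight would put the unit cube inside a union of boxes of
    small total volume. *)
Lemma hausdorff_measure_lt4 (s : R) : 0 <= s -> s < 4 ->
  hausdorff_measure d s setT <> 0%E.
Proof.
move=> s0 s4 H0.
have : (hausdorff_content d s 1 setT < (32^-1)%:E)%E.
  apply: (@le_lt_trans _ _ 0%E); last by rewrite lte_fin.
  by rewrite -H0; apply: ereal_sup_ubound; exists 1 => //=; exact: ltr01.
move=> /ereal_inf_lt[_ [U [U1 covU] <-]] Usmall.
have [B hB] := choice (fun k => diam_box s0 s4 (U1 k)).
have cover : (`[0, 1] `*` `[0, 1]) `*` `[0, 1] `<=` \bigcup_k B k.
  move=> [[u v] w] _; have [k _ Uk] := covU (mk u v w) I; exists k => //.
  by have [_ /(_ _ Uk) + _] := hB k; rewrite !heisE.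
have mB k : measurable (B k) by have [] := hB k.
have mC : measurable ((`[0, 1] `*` `[0, 1]) `*` `[0, 1] : set (R * R * R)).
  by apply: measurableX; [apply: measurableX|]; exact: measurable_itv.
have := measure_sigma_subadditive ((leb \x leb) \x leb)%E mB mC cover.
rewrite -/vol -[X in (X <= _)%E -> _]/(vol _) vol_unit_cube.
have : (\sum_(k <oo) vol (B k) <= 16%:E * \sum_(k <oo) diam_pow d s (U k))%E.
  rewrite -nneseriesZl; last by move=> k _; exact: diam_pow_ge0.
  apply: lee_nneseries => k *; first exact: measure_ge0.
  by have [] := hB k.
move=> le1 le2; have := le_trans le2 le1; apply/negP; rewrite -ltNge.
apply: (@le_lt_trans _ _ (16%:E * (32^-1)%:E)%E).
  by apply: lee_wpmul2l; [rewrite lee_fin|exact: ltW].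
by rewrite -EFinM lte_fin; lra.
Qed.

Lemma hausdorff_dim_ge4 : (4%:E <= hausdorff_dim d)%E.
Proof.
apply/ereal_infP => _ [s [s0 H0] <-]; rewrite lee_fin leNgt; apply/negP => s4.
exact: hausdorff_measure_lt4 s0 s4 H0.
Qed.

Lemma hausdorff_dim_heis : hausdorff_dim d = 4%:E.
Proof. by apply/eqP; rewrite eq_le hausdorff_dim_le4 hausdorff_dim_ge4. Qed.

End LowerBound.

(** * The homogeneous dimension *)

Section HomogeneousDimension.
Context (R : realType).
Implicit Types A B : 'M[R]_3.
Notation g := (heis_lie R).
Notation E01 := (delta_mx 0 1 : 'M[R]_3).
Notation E12 := (delta_mx 1 2 : 'M[R]_3).
Notation E02 := (delta_mx 0 2 : 'M[R]_3).

Lemma heis_lieP A : A \in g ->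
  exists a b c, A = a *: E01 + b *: E12 + c *: E02.
Proof.
rewrite /heis_lie !span_cons span_nil addv0.
move=> /memv_addP[_ /vlineP[a ->] [_ /memv_addP[_ /vlineP[b ->]
  [_ /vlineP[c ->] ->]] ->]].
by exists a, b, c; rewrite addrA.
Qed.

Lemma heis_bracket a b c a' b' c' :
  mx_bracket (a *: E01 + b *: E12 + c *: E02)
             (a' *: E01 + b' *: E12 + c' *: E02) =
  (a * b' - a' * b) *: E02.
Proof.
apply/matrixP => i j; rewrite !mxE !big_ord_recl !big_ord0 !mxE.
by case: i j => -[|[|[|//]]] ? [[|[|[|//]]] ?] /=; ring.
Qed.

Lemma dim_heis_lie : \dim g = 3.
Proof.
rewrite /heis_lie; apply/eqP; rewrite -/(free _); apply/freeP => k.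
rewrite !big_ord_recl big_ord0 /= => /matrixP k0.
have := k0 0 1; have := k0 1 2; have := k0 0 2.
rewrite !mxE /= !(mulr0, mulr1, addr0, add0r) => e2 e1 e0.
case=> [[|[|[|//]]] i3].
- by rewrite -[RHS]e0; congr k; apply/val_inj.
- by rewrite -[RHS]e1; congr k; apply/val_inj.
- by rewrite -[RHS]e2; congr k; apply/val_inj.
Qed.

Lemma E_in_heis_lie : [/\ E01 \in g, E12 \in g & E02 \in g].
Proof. by split; apply: memv_span; rewrite !inE eqxx ?orbT. Qed.

Lemma bracket_heis_lie : bracketv g g = <[E02]>%VS.
Proof.
apply/eqP; rewrite eqEsubv; apply/andP; split.
  apply/bracketvP => _ _ /heis_lieP[a [b [c ->]]] /heis_lieP[a' [b' [c' ->]]].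
  by rewrite heis_bracket memvZ// memv_line.
rewrite -memvE; have [e01 e12 _] := E_in_heis_lie.
have := (bracketvP g g _).2 (subvv _) _ _ e01 e12.
have := heis_bracket 1 0 0 0 1 0.
by rewrite !scale1r !scale0r !addr0 add0r mulr1 mul0r subr0 scale1r => ->.
Qed.

Lemma bracket_heis_center : bracketv g <[E02]> = 0%VS.
Proof.
apply/eqP; rewrite -subv0; apply/bracketvP.
move=> _ _ /heis_lieP[a [b [c ->]]] /vlineP[t ->].
have := heis_bracket a b c 0 0 t; rewrite !scale0r !add0r => ->.
by rewrite mulr0 mul0r subr0 scale0r mem0v.
Qed.

Lemma bracketv0 : bracketv g 0 = 0%VS.
Proof.
apply/eqP; rewrite -subv0; apply/bracketvP => x y _; rewrite memv0 => /eqP ->.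
by rewrite /mx_bracket mulmx0 mul0mx subr0 mem0v.
Qed.

(** The lower central series has dimensions 3, 1 and 0, whence
    [1 * (3 - 1) + 2 * (1 - 0)]. *)
Lemma homogeneous_dim_heis_lie : homogeneous_dim g = 4%:E.
Proof.
have lc1 : lower_central g 1 = g by [].
have lc2 : lower_central g 2 = <[E02]>%VS by rewrite -bracket_heis_lie.
have lc3 k : lower_central g k.+3 = 0%VS.
  elim: k => [|k IH].
    rewrite -[LHS]/(bracketv g (lower_central g 2)) lc2.
    exact: bracket_heis_center.
  by rewrite -[LHS]/(bracketv g (lower_central g k.+3)) IH bracketv0.
have E020 : E02 != 0.
  by apply/eqP => /matrixP/(_ 0 2)/eqP; rewrite !mxE /= oner_eq0.
pose u i : \bar R :=
  (i * (\dim (lower_central g i) - \dim (lower_central g i.+1)))%N%:R%:E.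
rewrite -[LHS]/(\sum_(1 <= i <oo) u i)%E.
have u0 i : (2 < i)%N -> u i = 0%E.
  by case: i => [|[|[|i]]]// _; rewrite /u !lc3 dimv0 subnn muln0.
rewrite (@finite_eseries _ _ 1 3)//.
rewrite 2?big_nat_recr ?big_nil//= /u lc1 lc2 lc3 dim_heis_lie dimv0.
by rewrite dim_vline E020 add0e -EFinD; rewrite -natrD.
Qed.

End HomogeneousDimension.

(** * The theorem *)

Theorem proposition1p7 (R : realType) :
  (forall f : R -> R,
    (forall t, 1 <= t -> 0 < f t) ->
    (forall s t, 1 <= s -> s <= t -> f s <= f t) ->
    f x @[x --> +oo] --> +oo ->
    exists S : nat -> {fset heis int},
      [/\ forall n, symmetric_fset (S n) /\ generating_fset (S n),
          exists C : R, forall n : nat, (0 < n)%N ->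
            (#|` fset_pow (S n) n|)%:R
              <= C * f n%:R * n%:R ^+ 3 * (#|` S n|)%:R &
          pointed_gh_cvg
            (fun (n : nat) (x y : heis int) =>
               word_dist R (S n.+1) x y / n.+1%:R)
            (fun=> 1%g)
            (cc_dist (@linf_norm R)) 1%g]) /\
  hausdorff_dim (cc_dist (@linf_norm R)) = homogeneous_dim (heis_lie R) /\
  homogeneous_dim (heis_lie R) = 4%:E.
Proof.
split; first exact: slow_growth_gh_cvg.
by rewrite hausdorff_dim_heis homogeneous_dim_heis_lie.
Qed.
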